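(* For every integer $k\ge 1$ there exists a simple, nonplanar, $3$-connected, bipartite cubic graph $U_k$ with $2+10k$ vertices and $K'(U_k,3)=1$.
   Context: A proper $3$-edge coloring assigns colors from $\{1,2,3\}$ to edges so that adjacent edges receive different colors. For colors $a\neq b$, an edge-Kempe chain is a connected component of the subgraph of edges colored $a$ or $b$; an edge-Kempe switch interchanges $a$ and $b$ on one chain. $K'(G,3)$ is the number of equivalence classes of proper $3$-edge colorings of $G$ under the equivalence relation generated by edge-Kempe switches. *)

(* Defs.v *)
From mathcomp Require Import all_boot fingroup perm.
Set Implicit Arguments. Unset Strict Implicit. Unset Printing Implicit Defensive.

Section Graphs.
Variable T : finType.
Variable e : rel T.

Definition simple_graph : Prop := symmetric e /\ irreflexive e.

Definition cubic : Prop := forall v : T, #|[set u | e v u]| = 3.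

Definition bipartite : Prop :=
  exists side : T -> bool, forall u v, e u v -> side u != side v.

Definition induced_connected (A : {set T}) : Prop :=
  forall x y, x \in A -> y \in A ->
    connect [rel a b | e a b && (a \in A) && (b \in A)] x y.

Definition three_connected : Prop :=
  3 < #|T| /\ forall S : {set T}, #|S| < 3 -> induced_connected (~: S).

Definition dart := {d : T * T | e d.1 d.2 && e d.2 d.1}.

Lemma drev_proof (d : dart) : e (val d).2 (val d).1 && e (val d).1 (val d).2.
Proof. by rewrite andbC; exact: (valP d). Qed.

Definition drev (d : dart) : dart :=
  @exist _ (fun d => e d.1 d.2 && e d.2 d.1) ((val d).2, (val d).1) (drev_proof d).

Definition rotation_system (sigma : {perm dart}) : Prop :=
  (forall d, (val (sigma d)).1 = (val d).1) /\
  (forall d d', (val d).1 = (val d').1 -> fconnect sigma d d').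

Definition num_faces (sigma : {perm dart}) : nat :=
  #|[set [set d' | fconnect (fun x => sigma (drev x)) d d'] | d : dart]|.

Definition num_edges : nat := #|{: dart}| %/ 2.

Definition num_components : nat :=
  #|[set [set y | connect e x y] | x : T]|.

Definition num_isolated : nat := #|[set x | [forall y, ~~ e x y]]|.

(** A graph is planar iff it has a rotation system of genus 0 on every
    component, i.e. V - E + F = 2 * (#components), where an isolated vertex
    counts as one face. *)
Definition planar : Prop :=
  exists sigma : {perm dart}, rotation_system sigma /\
    #|T| + num_faces sigma + num_isolated = 2 * num_components + num_edges.

Definition edge := {s : {set T} | [exists x, exists y, e x y && (s == [set x; y])]}.

Definition adjacent_edges (f g : edge) : bool :=
  (f != g) && [exists v, (v \in val f) && (v \in val g)].

Definition coloring := {ffun edge -> 'I_3}.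

Definition proper3 (c : coloring) : bool :=
  [forall f, forall g, adjacent_edges f g ==> (c f != c g)].

Definition ab_rel (c : coloring) (a b : 'I_3) : rel edge :=
  [rel f g | adjacent_edges f g && (c f \in [:: a; b]) && (c g \in [:: a; b])].

Definition in_chain (c : coloring) (a b : 'I_3) (f0 g : edge) : bool :=
  (c f0 \in [:: a; b]) && connect (ab_rel c a b) f0 g.

Definition swap_col (a b x : 'I_3) : 'I_3 :=
  if x == a then b else if x == b then a else x.

Definition kempe_switch (c : coloring) (f0 : edge) (a b : 'I_3) : coloring :=
  [ffun g => if in_chain c a b f0 g then swap_col a b (c g) else c g].

Definition kempe_step (c c' : coloring) : bool :=
  [&& proper3 c, proper3 c' &
    [exists f0, exists a, exists b, (a != b) && (c' == kempe_switch c f0 a b)]].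

Definition kempe_equiv : rel coloring :=
  connect [rel c c' | kempe_step c c' || kempe_step c' c].

Definition Kprime3 : nat :=
  #|[set [set c' | kempe_equiv c c'] | c in [set c : coloring | proper3 c]]|.

End Graphs.

(* Main.v *)
(* The graphs are chains: starting from the Franklin graph (12 vertices), the
   last vertex is repeatedly replaced by a cube minus a vertex (6 more vertices)
   or by a Franklin graph minus a vertex (10 more).

   K' = 1 is preserved by such a replacement. Parity forces the three edges
   leaving the gadget to have distinct colours, so a colouring of the new graph
   induces colourings of the old graph and of the gadget. A Kempe switch of the
   old graph lifts to the new one by letting the whole gadget follow the replaced
   vertex; this makes two colourings agree outside the gadget. Then one only
   needs that two colourings of the complete gadget which agree at the deleted
   vertex are related by switches of chains avoiding that vertex, a finite check
   for the two gadgets.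

   Nonplanarity is a count. All faces of a bipartite cubic graph have even length
   at least 4, so on the sphere Euler's formula leaves at least six faces of
   length 4. The cube contributes no 4-cycle in the interior of the chain, hence
   a chain of many cubes and at most three Franklin graphs has at most five
   4-cycles. *)
Require Import Defs.
From mathcomp Require Import all_boot fingroup perm.
From mathcomp Require Import zify.
Set Implicit Arguments. Unset Strict Implicit. Unset Printing Implicit Defensive.

(** * Edge colourings of graphs on an initial segment of nat *)

(** Each edge is read in both orientations, hence [sym_col]; values off the edges are immaterial. *)
Definition ecol := nat -> nat -> 'I_3.

Definition sym_col (E : rel nat) (c : ecol) := forall x y, E x y -> c x y = c y x.

Definition proper_at (E : rel nat) (c : ecol) x :=
  forall y z, E x y -> E x z -> y <> z -> c x y <> c x z.

Definition proper_col (E : rel nat) c := sym_col E c /\ forall x, proper_at E c x.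

Lemma swap_id (a b x : 'I_3) : ~~ ((x == a) || (x == b)) -> swap_col a b x = x.
Proof. by rewrite /swap_col; case: eqP => //=; case: eqP. Qed.

Lemma swapK (a b : 'I_3) : involutive (swap_col a b).
Proof.
move=> x; rewrite /swap_col; case: (eqVneq x a) => [->|xa].
  by rewrite eqxx; case: eqP.
case: (eqVneq x b) => [->|xb]; first by rewrite eqxx.
by rewrite (negPf xa) (negPf xb).
Qed.

(* A step switches the colours a, b on all edges at a set X of vertices that is
   a union of a/b-chains, i.e. several edge-Kempe switches at once; the
   vertices in Q are not allowed in X. *)
Inductive keq (E : rel nat) (Q : pred nat) : ecol -> ecol -> Prop :=
| keq_eq c d of (forall x y, E x y -> c x y = d x y) : keq E Q c d
| keq_step a b (X : pred nat) c c' d of a != b & (forall x, Q x -> X x = false)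
    & (forall x y, E x y -> (c x y == a) || (c x y == b) -> X x = X y)
    & (forall x y, E x y ->
         c' x y = if X x then swap_col a b (c x y) else c x y)
    & keq E Q c' d : keq E Q c d.

Section KempeEquivalence.
Variables (E : rel nat) (Q : pred nat).

Lemma keq_ext c c' d :
  (forall x y, E x y -> c x y = c' x y) -> keq E Q c' d -> keq E Q c d.
Proof.
move=> h k; elim: k c h => {c' d}.
  by move=> c' d h1 c h; apply: keq_eq => x y e; rewrite h // h1.
move=> a b X c' c1 d ab XQ Xc h1 k IH c h.
apply: (keq_step ab XQ _ _ k) => x y e; first by rewrite h //; apply: Xc.
by rewrite h1 // h.
Qed.

Lemma keq_trans c d e : keq E Q c d -> keq E Q d e -> keq E Q c e.
Proof.
elim=> {c d}; first by move=> c d h; apply: keq_ext.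
move=> a b X c c' d ab XQ Xc h1 k IH h.
by apply: (keq_step ab XQ Xc h1); apply: IH.
Qed.

(** Repeating a step undoes it: [swap_col a b] is an involution permuting [a] and [b], so [X] is
    still a union of a/b-chains after the switch. *)
Lemma keq_sym c d : keq E Q c d -> keq E Q d c.
Proof.
elim=> {c d} [c d h|a b X c d' d ab XQ Xc h _]; first by apply: keq_eq => x y /h.
move/keq_trans; apply; apply: (@keq_step _ _ a b X d' c c) => // [x y e|x y e|]; last exact: keq_eq.
  rewrite h //; case: ifP => Xx; last by rewrite -Xx; apply: Xc.
  rewrite !(can2_eq (swapK a b) (swapK a b)) => h'; rewrite -Xx; apply: (Xc x y e).
  move: h'; rewrite {1 2}/swap_col !eqxx orbC.
  by case: (eqVneq b a) ab => [->|]; rewrite ?eqxx.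
by rewrite h //; case: (X x); rewrite ?swapK.
Qed.

(** Renaming colours turns a/b-chains into chains of the new colours. This allows the finite check
    to normalise the colours at vertex 0. *)
Lemma keq_recolor (g : 'I_3 -> 'I_3) c d : injective g ->
  keq E Q c d -> keq E Q (fun x y => g (c x y)) (fun x y => g (d x y)).
Proof.
move=> gI; elim=> {c d} [c d h|a b X c d' d ab XQ Xc h _ IH].
  by apply: keq_eq => x y /h ->.
apply: (@keq_step _ _ (g a) (g b) X _ (fun x y => g (d' x y))) => // [|x y e|x y e].
- by rewrite (inj_eq gI).
- by rewrite !(inj_eq gI); apply: Xc.
- rewrite h //; case: (X x) => //; rewrite /swap_col !(inj_eq gI).
  by case: eqP => // _; case: eqP.
Qed.

Hypothesis Esym : symmetric E.

(** An edge coloured [a] or [b] has both ends inside or both outside [X], so [c'] stays symmetric;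
    at each vertex all colours are swapped or none, so it stays proper. *)
Lemma step_proper a b (X : pred nat) c c' :
    (forall x y, E x y -> (c x y == a) || (c x y == b) -> X x = X y) ->
    (forall x y, E x y ->
       c' x y = if X x then swap_col a b (c x y) else c x y) ->
  proper_col E c -> proper_col E c'.
Proof.
move=> Xc h [cs cp]; split=> [x y e|x y z ey ez yz].
  have e' : E y x by rewrite Esym.
  rewrite (h _ _ e) (h _ _ e') -(cs x y) //.
  case: (boolP ((c x y == a) || (c x y == b))) => [/(Xc _ _ e) -> //|/swap_id ->].
  by case: (X x); case: (X y).
rewrite (h _ _ ey) (h _ _ ez).
by case: (X x) => [/(can_inj (swapK a b))|]; apply: (cp x y z).
Qed.

End KempeEquivalence.

Lemma keq_sub E (Q Q' : pred nat) c d :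
  (forall x, Q' x -> Q x) -> keq E Q c d -> keq E Q' c d.
Proof.
move=> QQ'; elim=> {c d} [c d h|a b X c c' d ab XQ Xc h _]; first exact: keq_eq.
by apply: (keq_step ab _ Xc h) => x /QQ' /XQ.
Qed.

(** The step takes all vertices for [X]; for [a = b] nothing changes. *)
Lemma keq_swap E a b c : symmetric E -> proper_col E c ->
  let c' := fun x y => swap_col a b (c x y) in
  keq E pred0 c c' /\ proper_col E c'.
Proof.
move=> Esym cp c';
have h x y : E x y -> c' x y = if predT x then swap_col a b (c x y) else c x y by [].
split; last by apply: (@step_proper E Esym a b predT c).
case: (eqVneq a b) => [ab|ab]; last first.
  by apply: (@keq_step E pred0 a b predT c c') => //; apply: keq_eq.
by apply: keq_eq => x y _; rewrite /c' ab /swap_col; case: eqP.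
Qed.

(** * Connectivity after deleting vertices *)

Inductive reach (E : rel nat) (D : pred nat) (x : nat) : nat -> Prop :=
| reach_refl : reach E D x x
| reach_rcons y z of reach E D x y & E y z & D z : reach E D x z.

Section Reach.
Implicit Types (E : rel nat) (D : pred nat).

Lemma reach_trans E D x y z : reach E D x y -> reach E D y z -> reach E D x z.
Proof. by move=> xy; elim=> // u v _ xu uv Dv; apply: (reach_rcons xu uv Dv). Qed.

Lemma reach_edge E D x y : E x y -> D y -> reach E D x y.
Proof. by move=> e d; apply: (reach_rcons (reach_refl _ _ _) e d). Qed.

Lemma reach_in E D x y : D x -> reach E D x y -> D y.
Proof. by move=> ?; elim. Qed.

Lemma reach_sym E D x y :
  symmetric E -> D x -> reach E D x y -> reach E D y x.
Proof.
move=> Es Dx; elim=> [|y' z xy IH e Dz]; first exact: reach_refl.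
apply: reach_trans IH; apply: reach_edge; first by rewrite Es.
exact: reach_in xy.
Qed.

Lemma reach_map E D E' D' (f : nat -> nat) x y :
    (forall u v, D u -> D v -> E u v -> E' (f u) (f v) /\ D' (f v)) ->
  D x -> reach E D x y -> reach E' D' (f x) (f y).
Proof.
move=> h Dx; elim=> [|y' z xy IH e Dz]; first exact: reach_refl.
have [e' D'z] := h _ _ (reach_in Dx xy) Dz e.
exact: reach_rcons IH e' D'z.
Qed.

(** The walk is cut at its first visit to [w]. *)
Lemma reach_before E D x w : D x -> x != w -> reach E D x w ->
  exists2 y, reach E (fun z => D z && (z != w)) x y & E y w.
Proof.
move=> Dx xw r.
suff: forall y, reach E D x y -> reach E (fun z => D z && (z != w)) x y \/
    exists2 y, reach E (fun z => D z && (z != w)) x y & E y w.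
  case/(_ _ r) => // /reach_in; rewrite eqxx andbF.
  by move/(_ (introT andP (conj Dx xw))).
move=> y; elim=> [|u v _ [xu|?] uv Dv]; [by left; apply: reach_refl| |by right].
case: (eqVneq v w) uv => [-> uv|vw uv]; first (by right; exists u).
by left; apply: (reach_rcons xu uv); rewrite Dv.
Qed.

End Reach.

(** Taking [s = t], or values beyond the last vertex, also covers the deletion of one vertex or
    none. *)
Definition avoid s t : pred nat := fun z => (z != s) && (z != t).

(* The vertices are 0, ..., m, and the last three of them before m are the
   neighbours of m. *)
Record cubic3 (m : nat) (E : rel nat) : Prop := Cubic3 {
  size_ge : 7 <= m;
  adj_sym : symmetric E;
  adj_irr : irreflexive E;
  adj_le : forall x y, E x y -> y <= m;
  adj_last : forall x, E x m = (m - 3 <= x < m);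
  adj_cubic : forall x, x <= m ->
    exists s, [/\ uniq s, size s = 3 & forall y, E x y = (y \in s)];
  adj_bip : exists side : nat -> bool, forall x y, E x y -> side x != side y;
  adj_conn : forall s t x y, x <= m -> y <= m -> avoid s t x -> avoid s t y ->
    reach E (avoid s t) x y;
  adj_col : exists c, proper_col E c /\ forall x, E x m -> x = m - 3 + c x m }.

Definition adj_first (E : rel nat) := forall y, E 0 y = (0 < y < 4).

Definition kempe1 (E : rel nat) :=
  forall c d, proper_col E c -> proper_col E d -> keq E pred0 c d.

(* The vertex 0 of a gadget is to be deleted, hence a parity condition on
   colourings that need not be proper there, and switches that avoid it. *)
Record gadget (m : nat) (P : rel nat) : Prop := Gadget {
  gadget_cubic3 : cubic3 m P;
  gadget_first : adj_first P;
  gadget_parity : forall c, sym_col P c ->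
    (forall x, 0 < x -> proper_at P c x) -> proper_at P c 0;
  gadget_kempe : forall c d, proper_col P c -> proper_col P d ->
    (forall y, P 0 y -> c 0 y = d 0 y) -> keq P (pred1 0) c d;
  gadget_col : exists c, [/\ proper_col P c, forall x, P x m -> x = m - 3 + c x m
    & forall y, P 0 y -> y = (c 0 y).+1] }.

(* Switching all of the graph at once makes the colours at 0 agree. *)
Lemma gadget_kempe1 m P : gadget m P -> kempe1 P.
Proof.
move=> gP c d cp dp; have Ps := adj_sym (gadget_cubic3 gP).
have P0 y : 0 < y < 4 -> P 0 y by rewrite (gadget_first gP).
have ne e (ep : proper_col P e) y z : 0 < y < 4 -> 0 < z < 4 -> y <> z ->
    e 0 y != e 0 z.
  by case: ep => _ ep y4 z4 yz; apply/eqP/ep => //; apply: P0.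
have [k1 c1p] := keq_swap (c 0 1) (d 0 1) Ps cp.
set c1 := fun x y => _ in k1 c1p.
have [k2 c2p] := keq_swap (c1 0 2) (d 0 2) Ps c1p.
set c2 := fun x y => _ in k2 c2p.
apply: (keq_trans k1); apply: (keq_trans k2); apply: keq_sub (gadget_kempe gP c2p dp _) => //.
have e1 : c1 0 1 = d 0 1 by rewrite /c1 /swap_col eqxx.
have e21 : c2 0 1 = d 0 1.
  rewrite /c2 /swap_col e1 -{1}e1 (negPf (ne _ c1p 1 2 _ _ _)) //.
  by rewrite (negPf (ne _ dp 1 2 _ _ _)).
have e22 : c2 0 2 = d 0 2 by rewrite /c2 /swap_col eqxx.
move=> y; rewrite (gadget_first gP) => y4.
have: [|| y == 1, y == 2 | y == 3] by lia.
case/or3P=> /eqP -> //; apply: val_inj.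
have := ne _ c2p 1 3 isT isT; have := ne _ c2p 2 3 isT isT; have := ne _ c2p 1 2 isT isT.
have := ne _ dp 1 3 isT isT; have := ne _ dp 2 3 isT isT; rewrite e21 e22 -!val_eqE /=.
move: (ltn_ord (d 0 1)) (ltn_ord (d 0 2)) (ltn_ord (d 0 3)) (ltn_ord (c2 0 3)).
by set u := nat_of_ord _; set v := nat_of_ord _; set w := nat_of_ord _;
  set z := nat_of_ord _ => *; lia.
Qed.

(* The gadget minus its vertex 0 replaces the last vertex M: the gadget vertex
   p becomes M + p - 1, and its vertices 1, 2, 3 are joined to M - 3, M - 2 and
   M - 1. *)
Definition glue (M : nat) (E P : rel nat) : rel nat := fun x y =>
  if x < M then if y < M then E x y else (M - 3 <= x) && (y == x + 3)
  else if y < M then (M - 3 <= y) && (x == y + 3)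
  else P (x - M).+1 (y - M).+1.

(** 4-cycles are compared as vertex sets, so starting point and direction do not matter; [L] may
    contain further lists. *)
Definition quads (E : rel nat) (L : seq (seq nat)) :=
  forall a b c d, E a b -> E b c -> E c d -> E d a -> a != c -> b != d ->
    exists2 s, s \in L & s =i [:: a; b; c; d].

(* At most q quadrangles, of which at most p avoid M: the others disappear when M
   is replaced. *)
Definition few_quads (M : nat) (E : rel nat) p q := exists L : seq (seq nat),
  [/\ quads E L, count (fun s => M \notin s) L <= p & size L <= q].

(** * Replacing a vertex by a gadget *)

Section Glue.
Variables (M m : nat) (E P : rel nat).
Hypotheses (gE : cubic3 M E) (gP : gadget m P).

Let cP := gadget_cubic3 gP.
Let E' := glue M E P.
Let M7 := size_ge gE.
Let m7 := size_ge cP.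

Let glue_sym : symmetric E'.
Proof.
move=> x y; rewrite /E' /glue; case: ltnP => xM; case: ltnP => yM //.
  exact: (adj_sym gE).
exact: (adj_sym cP).
Qed.

Let first0 p : P p 0 = (0 < p < 4).
Proof. by rewrite (adj_sym cP) (gadget_first gP). Qed.

Let old_old x y : x < M -> y < M -> E' x y = E x y.
Proof. by rewrite /E' /glue => -> ->. Qed.

Let old_new x y : x < M -> M <= y -> E' x y = E x M && (y == x + 3).
Proof.
by move=> xM yM; rewrite /E' /glue xM ltnNge yM /= (adj_last gE) xM andbT.
Qed.

Let old_new_P x y : x < M -> M <= y -> E' x y -> P 0 (y - M).+1.
Proof. by move=> xM yM; rewrite old_new // (adj_last gE) (gadget_first gP); lia. Qed.

Let new_new x y : M <= x -> M <= y -> E' x y = P (x - M).+1 (y - M).+1.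
Proof. by move=> xM yM; rewrite /E' /glue !ltnNge xM yM. Qed.

(* Contracting the gadget to M, or the rest to the gadget vertex 0. *)
Let fo y := if y < M then y else M.
Let fp y := if y < M then 0 else (y - M).+1.

Let fo_adj x y : x < M -> E' x y -> E x (fo y).
Proof.
rewrite /fo => xM; case: ltnP => yM; first by rewrite old_old.
by rewrite old_new // => /andP [].
Qed.

Let fo_inj x y z : x < M -> E' x y -> E' x z -> fo y = fo z -> y = z.
Proof.
rewrite /fo => xM; case: ltnP => yM; case: ltnP => zM; try lia.
by rewrite !old_new // => /andP [_ /eqP ->] /andP [_ /eqP ->].
Qed.

Let fp_adj x y : M <= x -> E' x y -> P (x - M).+1 (fp y).
Proof.
rewrite /fp => xM; case: ltnP => yM; last by rewrite new_new.
by rewrite glue_sym (adj_sym cP); apply: old_new_P.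
Qed.

Let fp_inj x y z : M <= x -> E' x y -> E' x z -> fp y = fp z -> y = z.
Proof.
rewrite /fp => xM; case: ltnP => yM; case: ltnP => zM; try lia.
by rewrite glue_sym old_new // [E' x z]glue_sym old_new //; lia.
Qed.

Let old_lift x y : x < M -> E x y -> E' x (if y < M then y else x + 3).
Proof.
move=> xM xy; case: ltnP => yM; first by rewrite old_old.
have yE : y = M by have := adj_le gE xy; lia.
move: xy; rewrite yE => xy; rewrite old_new ?xy ?eqxx //.
by move: xy; rewrite (adj_last gE); lia.
Qed.

Let foK x y : E x y -> fo (if y < M then y else x + 3) = y.
Proof.
move=> xy; have := adj_le gE xy; rewrite /fo leq_eqVlt => /orP [/eqP yM|yM].
  by move: xy; rewrite yM ltnn (adj_last gE) => ?; rewrite ifF //; lia.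
by rewrite !yM.
Qed.

Let new_lift x q : M <= x -> P (x - M).+1 q ->
  E' x (if q == 0 then x - 3 else M + q.-1).
Proof.
move=> xM xq; case: eqP => [q0|q0].
  move: xq; rewrite q0 first0 => h.
  by rewrite glue_sym old_new ?(adj_last gE) //; lia.
rewrite new_new //; last by lia.
by rewrite (_ : (M + q.-1 - M).+1 = q) //; lia.
Qed.

Let fpK x q : M <= x -> P (x - M).+1 q ->
  fp (if q == 0 then x - 3 else M + q.-1) = q.
Proof.
move=> xM; case: eqP => [->|q0]; last by rewrite /fp ifF //; lia.
by rewrite first0 => ?; rewrite /fp ifT //; lia.
Qed.

Let M' := M + m.-1.

Let glue_irr : irreflexive E'.
Proof.
move=> x; case: (ltnP x M) => xM.
  by rewrite old_old // (adj_irr gE).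
by rewrite new_new // (adj_irr cP).
Qed.

Let glue_le x y : E' x y -> y <= M'.
Proof.
rewrite /M'; case: (ltnP y M) => yM; first by lia.
case: (ltnP x M) => xM; first by rewrite old_new //; lia.
by rewrite new_new // => /(adj_le cP); lia.
Qed.

Let glue_last x : E' x M' = (M' - 3 <= x < M').
Proof.
rewrite /M'; case: (ltnP x M) => xM; first by rewrite old_new ; lia.
rewrite new_new //; last by lia.
by rewrite (_ : (M + m.-1 - M).+1 = m) ?(adj_last cP) ; lia.
Qed.

Let glue_cubic x : x <= M' ->
  exists s, [/\ uniq s, size s = 3 & forall y, E' x y = (y \in s)].
Proof.
move=> xM'; case: (ltnP x M) => xM.
  have [s [us ss hs]] := adj_cubic gE (ltnW xM).
  exists [seq if y < M then y else x + 3 | y <- s]; split.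
  - rewrite map_inj_in_uniq // => y z; rewrite -!hs => xy xz yz.
    by rewrite -(foK xy) yz foK.
  - by rewrite size_map.
  - move=> y; apply/idP/mapP => [xy|[z]]; last by rewrite -hs => /(old_lift xM) ? ->.
    exists (fo y); first by rewrite -hs fo_adj.
    move: xy; rewrite /fo; case: (ltnP y M) => yM; rewrite ?yM // ltnn.
    by rewrite old_new // => /andP [_ /eqP].
have xm : (x - M).+1 <= m by move: xM'; rewrite /M'; lia.
have [s [us ss hs]] := adj_cubic cP xm.
exists [seq if q == 0 then x - 3 else M + q.-1 | q <- s]; split.
- rewrite map_inj_in_uniq // => y z; rewrite -!hs => xy xz yz.
  by rewrite -(fpK xM xy) yz fpK.
- by rewrite size_map.
- move=> y; apply/idP/mapP => [xy|[z]]; last by rewrite -hs => /(new_lift xM) ? ->.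
  exists (fp y); first by rewrite -hs fp_adj.
  move: xy; rewrite /fp; case: (ltnP y M) => yM /=; last by lia.
  by rewrite glue_sym old_new // => /andP [_ /eqP ->]; lia.
Qed.

Let glue_bip : exists side : nat -> bool, forall x y, E' x y -> side x != side y.
Proof.
have [sE hE] := adj_bip gE; have [sP hP] := adj_bip cP.
(* The sides of the gadget are flipped if necessary, so that the neighbours of 0, which take over
   the edges of [M], get the side of [M]. *)
pose side x := if x < M then sE x else sP (x - M).+1 (+) sP 0 (+) ~~ sE M.
have old_side x y : x < M -> E' x y -> side x != side y.
  move=> xM; rewrite /side xM; case: ltnP => yM.
    by rewrite old_old //; apply: hE.
  move=> xy; have := hP _ _ (old_new_P xM yM xy).
  move: xy; rewrite old_new // => /andP [/hE + _].
  by case: (sE x); case: (sE M); case: (sP 0); case: (sP _).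
exists side => x y xy; case: (ltnP x M) => xM; first exact: old_side.
case: (ltnP y M) => yM; first by rewrite eq_sym old_side // glue_sym.
move: xy; rewrite new_new // /side !ltnNge xM yM /= => /hP.
by case: (sE M); case: (sP 0); case: (sP _); case: (sP _).
Qed.

(** * 3-connectedness of the glued graph *)

Let shiftK p : 0 < p -> (M + p.-1 - M).+1 = p.
Proof. lia. Qed.

(** As [M] is one of the deleted vertices, the walk in [E] uses only edges that gluing keeps. *)
Let old_reach s t s' t' x y : x < M -> y < M ->
    avoid s t x -> avoid s t y -> (s == M) || (t == M) ->
    (forall z, z < M -> avoid s t z -> avoid s' t' z) ->
  reach E' (avoid s' t') x y.
Proof.
move=> xM yM ax ay stM h.
have := adj_conn gE (ltnW xM) (ltnW yM) ax ay.
apply: (@reach_map _ _ _ _ id) => // u v au av uv; rewrite /E' /glue.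
have vM : v < M by have := adj_le gE uv; move: av stM; rewrite /avoid; lia.
have uM : u < M.
  by rewrite (adj_sym gE) in uv; have := adj_le gE uv; move: au stM; rewrite /avoid; lia.
by rewrite uM vM; split=> //; apply: h.
Qed.

Let new_reach s t s' t' p q : p <= m -> q <= m ->
    avoid s t p -> avoid s t q -> (s == 0) || (t == 0) ->
    (forall z, 0 < z -> avoid s t z -> avoid s' t' (M + z.-1)) ->
  reach E' (avoid s' t') (M + p.-1) (M + q.-1).
Proof.
move=> pm qm ap aq st0 h.
have := adj_conn cP pm qm ap aq.
apply: (@reach_map _ _ _ _ (fun z => M + z.-1)) => // u v au av uv.
have u0 : 0 < u by move: au st0; rewrite /avoid; lia.
have v0 : 0 < v by move: av st0; rewrite /avoid; lia.
split; last exact: h.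
rewrite new_new ?leq_addr //.
by rewrite !shiftK.
Qed.

Let cut_edge i : i < 3 -> E' (M - 3 + i) (M + i).
Proof. by move=> i3; rewrite old_new ?(adj_last gE) //; lia. Qed.

Let conn_hub s t z : avoid s t z ->
    (forall x, x <= M' -> avoid s t x -> reach E' (avoid s t) x z) ->
  forall x y, x <= M' -> y <= M' -> avoid s t x -> avoid s t y ->
    reach E' (avoid s t) x y.
Proof.
move=> az h x y xM yM ax ay; apply: reach_trans (h x xM ax) _.
exact: reach_sym glue_sym ay (h y yM ay).
Qed.

(** The gadget without 0 is connected, so [M] can serve as hub. A walk in [E] from an old vertex to
    [M] is stopped at a neighbour [y] of [M] and continued along the edge from [y] to [y + 3]. *)
Let conn_old s t x y : s < M -> t < M -> x <= M' -> y <= M' ->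
  avoid s t x -> avoid s t y -> reach E' (avoid s t) x y.
Proof.
move=> sM tM; apply: (@conn_hub _ _ M); first by rewrite /avoid; lia.
move=> {}x {y}; rewrite /M' => xM' ax.
have inside z : M <= z -> z <= M + m.-1 -> reach E' (avoid s t) z M.
  move=> zM zM'; rewrite (_ : z = M + (z - M).+1.-1); last by lia.
  rewrite [X in reach _ _ _ X](_ : M = M + 1.-1); last by lia.
  by apply: (@new_reach 0 0) => //; rewrite /avoid; lia.
case: (ltnP x M) => xM; last exact: inside.
have aM : avoid s t M by rewrite /avoid; lia.
have xnM : x != M by lia.
have [y xy] := reach_before ax xnM (adj_conn gE (ltnW xM) (leqnn M) ax aM).
rewrite (adj_last gE) => yM.
apply: (@reach_trans _ _ _ y).
  have axM : avoid s t x && (x != M) by rewrite ax.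
  apply: (reach_map (f := id)) axM xy => u v /andP [_ uM] /andP [av vM] uv.
  split=> //; have vM' := adj_le gE uv.
  have uM' : u <= M by apply: (@adj_le _ _ gE v); rewrite (adj_sym gE).
  by rewrite old_old // ltn_neqAle ?uM ?vM.
apply: (@reach_trans _ _ _ (y + 3)); last by apply: inside; lia.
apply: reach_edge; last by rewrite /avoid; lia.
by rewrite old_new ?(adj_last gE); lia.
Qed.

Let conn_mixed s t x y : M <= s -> t < M -> x <= M' -> y <= M' ->
  avoid s t x -> avoid s t y -> reach E' (avoid s t) x y.
Proof.
move=> sM tM.
(* The three edges across the cut are disjoint, and [s] and [t] each hit at most one of them. *)
have [i [i3 it is_]] : exists i, [/\ i < 3, M - 3 + i != t & M + i != s].
  case: (boolP ((M - 3 != t) && (M != s))) => h0.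
    by exists 0; split; lia.
  case: (boolP ((M - 3 + 1 != t) && (M + 1 != s))) => h1.
    by exists 1; split; lia.
  by exists 2; split; lia.
apply: (@conn_hub _ _ (M + i)); first by rewrite /avoid; lia.
move=> {}x {y}; rewrite /M' => xM' ax.
case: (ltnP x M) => xM; last first.
  rewrite (_ : x = M + (x - M).+1.-1); last by lia.
  rewrite [M + i](_ : _ = M + i.+1.-1); last by lia.
  by apply: (@new_reach 0 (s - M).+1) => //; move: ax; rewrite /avoid; lia.
apply: (@reach_trans _ _ _ (M - 3 + i)).
  by apply: (@old_reach M t) => //; move: ax; rewrite /avoid; lia.
apply: (reach_edge (cut_edge i3)); by rewrite /avoid; lia.
Qed.

(** Mirror image of [conn_old]: the old side without [M] is connected, and a walk in [P] towards 0
    is stopped at a neighbour of 0. *)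
Let conn_new s t x y : M <= s -> M <= t -> x <= M' -> y <= M' ->
  avoid s t x -> avoid s t y -> reach E' (avoid s t) x y.
Proof.
move=> sM tM; apply: (@conn_hub _ _ M.-1); first by rewrite /avoid; lia.
move=> {}x {y}; rewrite /M' => xM' ax.
have inside z : z < M -> reach E' (avoid s t) z M.-1.
  by move=> zM; apply: (@old_reach M M) => //; rewrite /avoid; lia.
case: (ltnP x M) => xM; first exact: inside.
set p := (x - M).+1; have xp : x = M + p.-1 by rewrite /p; lia.
have ap : avoid (s - M).+1 (t - M).+1 p by move: ax; rewrite /avoid /p; lia.
have a0 : avoid (s - M).+1 (t - M).+1 0 by [].
have pm : p <= m by rewrite /p; lia.
have p0 : p != 0 by [].
have [q pq] := reach_before ap p0 (adj_conn cP pm (leq0n m) ap a0).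
rewrite first0 => q3.
apply: (@reach_trans _ _ _ (M + q.-1)).
  rewrite xp.
  have app : avoid (s - M).+1 (t - M).+1 p && (p != 0) by rewrite ap.
  apply: (reach_map (f := fun z => M + z.-1)) app pq => u v.
  rewrite -!lt0n => /andP [_ u0] /andP [av v0] uv.
  split; last by move: av; rewrite /avoid; lia.
  rewrite new_new ?leq_addr //.
  by rewrite !shiftK.
apply: (@reach_trans _ _ _ (M - 3 + q.-1)); last by apply: inside; lia.
by apply: reach_edge; [rewrite glue_sym; apply: cut_edge|rewrite /avoid]; lia.
Qed.

Let glue_conn s t x y : x <= M' -> y <= M' ->
  avoid s t x -> avoid s t y -> reach E' (avoid s t) x y.
Proof.
case: (ltnP s M) => sM; case: (ltnP t M) => tM xM yM ax ay.
- exact: conn_old.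
- have sw z : avoid s t z = avoid t s z by rewrite /avoid andbC.
  rewrite !sw in ax ay; have := conn_mixed tM sM xM yM ax ay.
  by apply: (@reach_map _ _ _ _ id) => // u v; rewrite sw.
- exact: conn_mixed.
- exact: conn_new.
Qed.

(** The normalisations at [M] and at 0 match: the edges from [M - 3 + i] to [M] and from 0 to
    [i + 1] both have colour [i], and gluing merges them. *)
Let glue_col (c d : ecol) : proper_col E c -> (forall x, E x M -> x = M - 3 + c x M) ->
    proper_col P d -> (forall y, P 0 y -> y = (d 0 y).+1) ->
  proper_col E' (fun x y => if x < M then c x (fo y)
    else if y < M then c M y else d (x - M).+1 (y - M).+1).
Proof.
move=> [cs cp] cM [ds dp] d0.
have cut x y : x < M -> M <= y -> E' x y -> c x M = d (y - M).+1 0.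
  move=> xM yM xy; have Py := old_new_P xM yM xy.
  rewrite -ds //; apply: val_inj; have := d0 _ Py.
  move: xy; rewrite old_new // => /andP [xM3 /eqP ->].
  by have := cM _ xM3; move: xM3; rewrite (adj_last gE) /=; lia.
split=> [x y xy|x y z].
  rewrite /fo; case: (ltnP x M) => xM; case: (ltnP y M) => yM.
  - by rewrite cs // -old_old.
  - by rewrite cs //; move: xy; rewrite old_new // => /andP [].
  - by rewrite cs // (adj_sym gE); move: xy; rewrite glue_sym old_new // => /andP [].
  - by rewrite ds // -new_new.
case: (ltnP x M) => xM xy xz yz.
  by apply: cp; rewrite ?fo_adj // => /(fo_inj xM xy xz).
have dfp u : E' x u -> (if u < M then c M u else d (x - M).+1 (u - M).+1) =
    d (x - M).+1 (fp u).
  rewrite /fp; case: (ltnP u M) => uM // xu.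
  have ux : E' u x by rewrite glue_sym.
  rewrite -(cut _ _ uM xM ux) cs // (adj_sym gE).
  by move: ux; rewrite old_new // => /andP [].
by rewrite !dfp //; apply: dp; rewrite ?fp_adj // => /(fp_inj xM xy xz).
Qed.

Lemma glue_cubic3 : cubic3 M' E'.
Proof.
have [c [cp cM]] := adj_col gE; have [d [dp dm d0]] := gadget_col gP.
split; [by rewrite /M'; lia|exact: glue_sym|exact: glue_irr|exact: glue_le
  |exact: glue_last|exact: glue_cubic|exact: glue_bip|exact: glue_conn|].
eexists; split; first exact: (glue_col cp cM dp d0).
move=> x; rewrite glue_last => xM; move: (xM); rewrite /M' => h.
rewrite ltnNge (_ : M <= x) /=; last by lia.
rewrite ltnNge (_ : M <= M + m.-1) /=; last by lia.
rewrite (_ : (M + m.-1 - M).+1 = m); last by lia.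
have := dm (x - M).+1; rewrite (adj_last cP).
by set v := nat_of_ord _; lia.
Qed.

(* The colourings induced on E and P; at the deleted vertices they take the
   colours of the three edges x -- x + 3 joining the two sides. *)
Let res_old (c : ecol) : ecol := fun x y =>
  if x == M then c y (y + 3) else if y == M then c x (x + 3) else c x y.
Let res_new (c : ecol) : ecol := fun p q =>
  if p == 0 then c (M + q.-1 - 3) (M + q.-1)
  else if q == 0 then c (M + p.-1 - 3) (M + p.-1) else c (M + p.-1) (M + q.-1).

Let old_cases x y : E x y ->
  [\/ [/\ x < M, y < M & E' x y], [/\ x < M, y = M & E' x (x + 3)]
    | [/\ x = M, y < M & E' y (y + 3)]].
Proof.
move=> xy; have yM := adj_le gE xy; have xM : x <= M.
  by apply: (@adj_le _ _ gE y); rewrite (adj_sym gE).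
move: xM; rewrite leq_eqVlt => /orP [/eqP|] xM;
  move: yM; rewrite leq_eqVlt => /orP [/eqP|] yM.
- by move: xy; rewrite xM yM (adj_irr gE).
- apply: Or33; split=> //; move: xy; rewrite (adj_sym gE) xM => xy.
  by have := old_lift yM xy; rewrite ltnn.
- by apply: Or32; split=> //; have := old_lift xM xy; rewrite yM ltnn.
- by apply: Or31; split=> //; rewrite old_old.
Qed.

Let res_old_fo c x y : x < M -> E' x y -> res_old c x (fo y) = c x y.
Proof.
move=> xM xy; rewrite /res_old /fo (ltn_eqF xM).
case: (ltnP y M) => yM; first by rewrite (ltn_eqF yM).
by move: xy; rewrite eqxx old_new // => /andP [_ /eqP ->].
Qed.

Let res_new_fp c x y : sym_col E' c -> M <= x -> E' x y ->
  res_new c (x - M).+1 (fp y) = c x y.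
Proof.
move=> cs xM xy; rewrite /res_new /fp /=.
have xE : M + (x - M) = x by lia.
case: (ltnP y M) => yM /=; last by rewrite xE (_ : M + (y - M) = y) //; lia.
rewrite (cs _ _ xy); move: xy; rewrite glue_sym old_new // => /andP [_ /eqP h].
by rewrite xE h addnK.
Qed.

Let res_old_sym c : sym_col E' c -> sym_col E (res_old c).
Proof.
move=> cs x y /old_cases [] []; rewrite /res_old.
- by move=> xM yM xy; rewrite (ltn_eqF xM) (ltn_eqF yM) cs.
- by move=> xM -> _; rewrite eqxx (ltn_eqF xM).
- by move=> -> yM _; rewrite eqxx (ltn_eqF yM).
Qed.

Let new_cases p q : P p q ->
  [\/ [/\ 0 < p, 0 < q & E' (M + p.-1) (M + q.-1)],
      [/\ 0 < p, q = 0 & E' (M + p.-1 - 3) (M + p.-1)]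
    | [/\ p = 0, 0 < q & E' (M + q.-1 - 3) (M + q.-1)]].
Proof.
have cut r : 0 < r < 4 -> E' (M + r.-1 - 3) (M + r.-1).
  by move=> h; rewrite old_new ?(adj_last gE) //; lia.
case: p => [|p]; case: q => [|q] pq.
- by rewrite (adj_irr cP) in pq.
- by apply: Or33; split=> //; apply: cut; rewrite -(gadget_first gP).
- by apply: Or32; split=> //; apply: cut; rewrite -first0.
- by apply: Or31; split=> //; rewrite new_new ?leq_addr // !shiftK.
Qed.

Let res_new_sym c : sym_col E' c -> sym_col P (res_new c).
Proof.
move=> cs p q /new_cases [] []; rewrite /res_new.
- by case: p => // p _; case: q => // q _ /cs.
- by case: p => // p _ ->.
- by case: q => // q -> _.
Qed.

(** At positive vertices properness is inherited; at the contracted vertex 0 it comes from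
    [gadget_parity]. *)
Let res_new_proper c : proper_col E' c -> proper_col P (res_new c).
Proof.
move=> [cs cp]; have rs := res_new_sym cs; split=> //.
have pos p : 0 < p -> proper_at P (res_new c) p.
  move=> p0 y z py pz yz.
  have xM : M <= M + p.-1 by apply: leq_addr.
  rewrite -(shiftK p0) in py pz *.
  have := res_new_fp cs xM (new_lift xM py).
  have := res_new_fp cs xM (new_lift xM pz).
  rewrite !fpK // => -> ->; apply: cp; try exact: new_lift.
  by move=> h; apply: yz; rewrite -(fpK xM py) h fpK.
by case=> [|p]; [apply: (gadget_parity gP)|apply: pos].
Qed.

(** At [M] the induced colours are those of the cut edges, which [res_new_proper] shows to be
    distinct. *)
Let res_old_proper c : proper_col E' c -> proper_col E (res_old c).
Proof.
move=> cp; have [cs cp'] := cp; split; first exact: res_old_sym.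
move=> x; case: (ltnP x M) => xM y z xy xz yz.
  rewrite -(foK xy) -(foK xz) !res_old_fo //; try exact: old_lift.
  apply: cp'; try exact: old_lift.
  by move=> h; apply: yz; rewrite -(foK xy) h foK.
have xE : x = M.
  by apply/eqP; rewrite eqn_leq xM andbT; apply: (@adj_le _ _ gE y); rewrite (adj_sym gE).
move: xy xz; rewrite /res_old xE eqxx !(adj_sym gE M) !(adj_last gE) => yM zM.
have [_ /(_ 0) h] := res_new_proper cp.
(* The neighbour [M - 3 + i] of [M] corresponds to the neighbour [i + 1] of 0. *)
have := h (y + 4 - M) (z + 4 - M); rewrite !(gadget_first gP) /res_new /=.
rewrite (_ : M + (y + 4 - M).-1 = y + 3); last by lia.
rewrite (_ : M + (z + 4 - M).-1 = z + 3); last by lia.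
by rewrite !addnK; apply; lia.
Qed.

Let switch (a b : 'I_3) (X : pred nat) (c : ecol) : ecol :=
  fun x y => if X x then swap_col a b (c x y) else c x y.

(* The whole gadget follows M. *)
Let lift_old c0 d0 : keq E pred0 c0 d0 ->
    forall c, proper_col E' c -> (forall x y, E x y -> c0 x y = res_old c x y) ->
  exists c', [/\ keq E' pred0 c c', proper_col E' c'
    & forall x y, E x y -> res_old c' x y = d0 x y].
Proof.
elim=> {c0 d0} [c0 d0 h c cp hc|a b X c0 c1 d0 ab _ Xc h k IH c cp hc].
  exists c; split=> // [|x y xy]; first exact: keq_eq.
  by rewrite -hc // h.
have [cs _] := cp.
pose X' x := if x < M then X x else X M.
have X'c x y : E' x y -> (c x y == a) || (c x y == b) -> X' x = X' y.
  have half u v : u < M -> E' u v -> (c u v == a) || (c u v == b) -> X' u = X' v.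
    move=> uM uv; rewrite -(res_old_fo c uM uv) -hc ?fo_adj //.
    move/(Xc _ _ (fo_adj uM uv)); rewrite /X' /fo uM.
    by case: (ltnP v M).
  move=> xy; case: (ltnP x M) => xM; first exact: half.
  case: (ltnP y M) => yM; last by rewrite /X' !ltnNge xM yM.
  by rewrite cs // => /(half y x yM) -> //; rewrite glue_sym.
have hX x y : E' x y -> switch a b X' c x y =
    if X' x then swap_col a b (c x y) else c x y by [].
have c'p := step_proper glue_sym X'c hX cp.
have rel_c1 x y : E x y -> c1 x y = res_old (switch a b X' c) x y.
  move=> xy; rewrite h // hc // /switch /X' /res_old.
  case: (old_cases xy) => [] []; first by move=> xM yM _; rewrite !ltn_eqF // xM.
    by move=> xM -> _; rewrite ltn_eqF // eqxx xM.
  (* At [M] the switch is governed by [X M], but the induced colour is read at [y]. Either the edge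
     lies in an a/b-chain and [X] agrees at its ends, or its colour is fixed by the swap. *)
  move=> xE yM _; have := Xc _ _ xy; rewrite hc // /res_old xE eqxx yM.
  case: (boolP ((c y (y + 3) == a) || _)) => [_ -> //|/swap_id -> _].
  by rewrite !if_same.
have [c' [k' c'p' hc']] := IH _ c'p rel_c1.
by exists c'; split=> //; apply: (keq_step ab _ X'c hX k').
Qed.

(** Since 0 is not in [X], the lifted set lies inside the gadget and no edge with an old end changes
    colour. *)
Let lift_new c0 d0 : keq P (pred1 0) c0 d0 ->
    forall c, proper_col E' c -> (forall p q, P p q -> c0 p q = res_new c p q) ->
  exists c', [/\ keq E' pred0 c c', proper_col E' c',
    forall p q, P p q -> res_new c' p q = d0 p q
    & forall x y, x < M -> E' x y -> c' x y = c x y].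
Proof.
elim=> {c0 d0} [c0 d0 h c cp hc|a b X c0 c1 d0 ab X0 Xc h k IH c cp hc].
  exists c; split=> // [|x y xy]; first exact: keq_eq.
  by rewrite -hc // h.
have [cs _] := cp; have {}X0 : X 0 = false by apply: X0.
pose X' x := if x < M then false else X (x - M).+1.
have X'fp x : X' x = X (fp x) by rewrite /X' /fp; case: ltnP.
have X'c x y : E' x y -> (c x y == a) || (c x y == b) -> X' x = X' y.
  have half u v : M <= u -> E' u v -> (c u v == a) || (c u v == b) -> X' u = X' v.
    move=> uM uv; rewrite -(res_new_fp cs uM uv) -hc ?fp_adj //.
    by move/(Xc _ _ (fp_adj uM uv)); rewrite !X'fp {2}/fp ltnNge uM.
  move=> xy; case: (ltnP x M) => xM; last exact: half.
  case: (ltnP y M) => yM; first by rewrite /X' xM yM.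
  by rewrite cs // => /(half y x yM) -> //; rewrite glue_sym.
have hX x y : E' x y -> switch a b X' c x y =
    if X' x then swap_col a b (c x y) else c x y by [].
have c'p := step_proper glue_sym X'c hX cp.
have rel_c1 p q : P p q -> c1 p q = res_new (switch a b X' c) p q.
  move=> pq; rewrite h // hc // /switch /res_new.
  have fpS r : fp (M + r) = r.+1 by rewrite /fp ltnNge leq_addr /= (shiftK (ltn0Sn r)).
  case: (new_cases pq) => [] [].
  - by case: p {pq} => // p _; case: q => // q _ _; rewrite !X'fp /= fpS.
  - case: p pq => // p pq _ qE e; rewrite qE /=; have := Xc _ _ pq.
    have eM : M + p - 3 < M by move: pq; rewrite qE first0; lia.
    rewrite hc // /res_new qE X0 /= !X'fp {1}/fp eM X0.
    case: (boolP ((c _ _ == a) || _)) => [_ -> //|/swap_id -> _].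
    by rewrite !if_same.
  - case: q pq => // q + pE; rewrite pE => pq _ e; rewrite X0 /= !X'fp.
    have eM : M + q - 3 < M by move: pq; rewrite (gadget_first gP); lia.
    by rewrite /fp eM X0.
have [c' [k' c'p' hc' ho]] := IH _ c'p rel_c1.
exists c'; split=> //; first exact: (keq_step ab _ X'c hX k').
by move=> x y xM xy; rewrite ho // /switch /X' xM.
Qed.

Lemma glue_kempe : kempe1 E -> kempe1 E'.
Proof.
move=> kE c d cp dp.
have [c1 [k1 c1p h1]] :=
  lift_old (kE _ _ (res_old_proper cp) (res_old_proper dp)) cp (fun _ _ _ => erefl).
have [ds _] := dp; have [c1s _] := c1p.
have eq_old x y : x < M -> E' x y -> c1 x y = d x y.
  by move=> xM xy; rewrite -(res_old_fo c1 xM xy) -(res_old_fo d xM xy) h1 ?fo_adj.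
(* At 0 the induced colourings only read the cut edges, where [c1] and [d] already agree. *)
have eq_at0 q : P 0 q -> res_new c1 0 q = res_new d 0 q.
  move=> q0; rewrite /res_new eqxx; case: (new_cases q0) => [] [] // _ _ e.
  by apply: eq_old => //; move: q0; rewrite (gadget_first gP); lia.
have [c2 [k2 [c2s _] h2 ho]] := lift_new (gadget_kempe gP (res_new_proper c1p)
  (res_new_proper dp) eq_at0) c1p (fun _ _ _ => erefl).
apply: (keq_trans k1); apply: (keq_trans k2); apply: keq_eq => x y xy.
case: (ltnP x M) => xM; first by rewrite ho // eq_old.
by rewrite -(res_new_fp c2s xM xy) -(res_new_fp ds xM xy) h2 ?fp_adj.
Qed.

(** No 4-cycle crosses the cut, so those of the new graph come from 4-cycles of [E] avoiding [M] or
    of [P] avoiding 0. Those of the first kind also avoid the new last vertex. *)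
Lemma glue_quads L p q p1 q1 : few_quads M E p q -> quads P L ->
    count (fun s => (0 \notin s) && (m \notin s)) L <= p1 ->
    count (fun s => 0 \notin s) L <= q1 ->
  few_quads M' E' (p + p1) (p + q1).
Proof.
move=> [LE [qE cE _]] qP cp1 cq1.
pose f r := M + r.-1.
exists ([seq s <- LE | M \notin s] ++ [seq map f s | s <- L & 0 \notin s]).
(* A crossing 4-cycle would use two of the disjoint cut edges, with adjacent old ends [a] and [d];
   these form a triangle with [M] in the bipartite graph [E]. *)
have mixed a b c d : E' a b -> E' b c -> E' c d -> E' d a -> a != c -> b != d ->
    a < M -> b < M.
  move=> ab bc cd da ac bd aM; case: (ltnP b M) => // bM; exfalso.
  move: ab; rewrite old_new // => /andP [Ea /eqP bE].
  case: (ltnP d M) => dM; last first.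
    by move: da; rewrite glue_sym old_new // => /andP [_]; lia.
  case: (ltnP c M) => cM.
    by move: bc; rewrite glue_sym old_new // => /andP [_]; lia.
  move: cd; rewrite glue_sym old_new // => /andP [Ed _].
  move: da; rewrite old_old // => Eda; have [side hs] := adj_bip gE.
  by move: (hs _ _ Ea) (hs _ _ Ed) (hs _ _ Eda); case: (side a); case: (side d); case: (side M).
have fK a : M <= a -> f (a - M).+1 = a by rewrite /f /=; lia.
split; last 2 first.
- rewrite count_cat leq_add //.
    by apply: leq_trans (count_size _ _) _; rewrite size_filter.
  rewrite count_map count_filter; apply: leq_trans cp1; apply: sub_count => s /=.
  case/andP=> h ->; apply: contra h => ms; apply/mapP; by exists m.
- by rewrite size_cat size_map !size_filter leq_add.
move=> a b c d ab bc cd da ac bd.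
have db : d != b by rewrite eq_sym.
have ca : c != a by rewrite eq_sym.
case: (ltnP a M) => aM.
  have bM : b < M by apply: (mixed a b c d).
  have cM : c < M by apply: (mixed b c d a).
  have dM : d < M by apply: (mixed c d a b).
  move: ab bc cd da; rewrite !old_old // => ab bc cd da.
  have [s sL sE] := qE a b c d ab bc cd da ac bd.
  by exists s => //; rewrite mem_cat mem_filter sE sL !inE; lia.
have dM : M <= d by rewrite leqNgt; apply/negP => /(mixed d a b c da ab bc cd db ac); lia.
have cM : M <= c by rewrite leqNgt; apply/negP => /(mixed c d a b cd da ab bc ca db); lia.
have bM : M <= b by rewrite leqNgt; apply/negP => /(mixed b c d a bc cd da ab bd ca); lia.
move: ab bc cd da; rewrite !new_new // => ab bc cd da.
have [||s sL sE] := qP _ _ _ _ ab bc cd da; try lia.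
exists (map f s).
  rewrite mem_cat; apply/orP; right; apply: map_f.
  by rewrite mem_filter sL sE !inE.
by move=> y; rewrite (eq_mem_map f sE) /= !fK.
Qed.

End Glue.

(** * The two gadgets *)

Definition adj_of (t : seq (seq nat)) : rel nat := fun x y => y \in nth [::] t x.

Section Checks.
Variables (m : nat) (t : seq (seq nat)).
Let P := adj_of t.
Let V := iota 0 m.+1.

Definition check_simple := [&& 7 <= m, size t == m.+1,
  all (fun x => (x \notin nth [::] t x) && uniq (nth [::] t x)
    && (size (nth [::] t x) == 3)) V,
  all (fun x => all (fun y => (y <= m) && P y x) (nth [::] t x)) V,
  nth [::] t 0 == [:: 1; 2; 3] & nth [::] t m == [:: m - 3; m - 2; m - 1]].

Hypothesis simple : check_simple.

Lemma check_size_ge : 7 <= m.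
Proof. by case/and5P: simple. Qed.

Lemma check_dom x y : P x y -> x <= m.
Proof.
rewrite leqNgt => xy; apply/negP => mx; move: xy; rewrite /P /adj_of nth_default //.
by case/and5P: simple => _ /eqP ->.
Qed.

Lemma check_V x y : P x y -> x \in V.
Proof. by move/check_dom; rewrite mem_iota. Qed.

Lemma check_rev x y : P x y -> (y <= m) && P y x.
Proof. by move=> xy; case/and5P: simple => _ _ _ /allP /(_ x (check_V xy)) /allP /(_ y xy). Qed.

Lemma check_sym : symmetric P.
Proof. by move=> x y; apply/idP/idP => /check_rev /andP []. Qed.

Lemma check_le x y : P x y -> y <= m.
Proof. by move=> /check_rev /andP []. Qed.

Lemma check_irr : irreflexive P.
Proof.
move=> x; apply/negP => xx; case/and5P: simple => _ _ /allP /(_ x (check_V xx)).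
by rewrite [_ \notin _](negbF xx).
Qed.

Lemma check_last x : P x m = (m - 3 <= x < m).
Proof.
rewrite check_sym /P /adj_of; case/and5P: simple => m7 _ _ _ /andP [_ /eqP ->].
by rewrite !inE; lia.
Qed.

Lemma check_first : adj_first P.
Proof.
move=> y; rewrite /P /adj_of; case/and5P: simple => m7 _ _ _ /andP [/eqP -> _].
by rewrite !inE; lia.
Qed.

Lemma check_cubic x : x <= m ->
  exists s, [/\ uniq s, size s = 3 & forall y, P x y = (y \in s)].
Proof.
move=> xm; exists (nth [::] t x); case/and5P: simple => _ _ /allP /(_ x).
by rewrite mem_iota /= add0n ltnS => /(_ xm) /andP [/andP [_ ->] /eqP ->].
Qed.

Definition check_bip (side : seq bool) :=
  all (fun x => all (fun y => nth false side x != nth false side y) (nth [::] t x)) V.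

Lemma check_bipP side : check_bip side ->
  exists side : nat -> bool, forall x y, P x y -> side x != side y.
Proof.
move=> /allP h; exists (nth false side) => x y xy.
exact: (allP (h x (check_V xy))).
Qed.

Fixpoint ball s u k x := if k is k'.+1 then
    let B := ball s u k' x in
    [seq y <- V | (y \in B) || avoid s u y && has (fun z => y \in nth [::] t z) B]
  else [:: x].

Lemma ball_reach s u k x y : y \in ball s u k x -> reach P (avoid s u) x y.
Proof.
elim: k y => [|k IH] y; first by rewrite inE => /eqP ->; apply: reach_refl.
rewrite /ball -/(ball s u k x) mem_filter => /andP [/orP [/IH //|/andP [ay /hasP [z /IH xz zy]]] _].
exact: reach_rcons xz zy ay.
Qed.

(** The value [m + 1] is no vertex and represents all deletions out of range. *)
Definition check_conn := all (fun s => all (fun u =>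
  let W := [seq x <- V | avoid s u x] in
  all (mem (ball s u m (head 0 W))) W) (iota 0 m.+2)) (iota 0 m.+2).

Lemma check_connP : check_conn -> forall s u x y, x <= m -> y <= m ->
  avoid s u x -> avoid s u y -> reach P (avoid s u) x y.
Proof.
move=> chk s u x y xm ym ax ay.
have h z : z <= m -> avoid s u z = avoid (minn s m.+1) (minn u m.+1) z.
  by rewrite /avoid; lia.
apply: (reach_map (f := id) (E := P) (D := avoid (minn s m.+1) (minn u m.+1))).
- by move=> v w av aw vw; split=> //; rewrite h // (check_le vw).
- by rewrite -h.
rewrite h // in ax; rewrite h // in ay.
have le_m v : minn v m.+1 \in iota 0 m.+2 by rewrite mem_iota; lia.
move/allP: chk => /(_ _ (le_m s)) /allP /(_ _ (le_m u)) /allP.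
set W := [seq _ <- V | _]; set x0 := head 0 W => chk.
have inW z : z <= m -> avoid (minn s m.+1) (minn u m.+1) z -> z \in W.
  by move=> zm az; rewrite mem_filter az mem_iota.
have W0 : x0 \in W.
  by rewrite /x0; have := inW x xm ax; case: (W) => //= z W' _; rewrite mem_head.
have a0 : avoid (minn s m.+1) (minn u m.+1) x0 by move: W0; rewrite mem_filter => /andP [].
apply: reach_trans (reach_sym check_sym a0 (ball_reach (chk _ (inW x xm ax)))) _.
exact: (ball_reach (chk _ (inW y ym ay))).
Qed.

Definition check_quads (L : seq (seq nat)) :=
  all (fun a => all (fun b => all (fun c => all (fun d =>
    [|| a == c, b == d, a \notin nth [::] t d
      | has (fun s => all (fun v => v \in s) [:: a; b; c; d]
        && all (fun v => v \in [:: a; b; c; d]) s) L])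
    (nth [::] t c)) (nth [::] t b)) (nth [::] t a)) V.

Lemma check_quadsP L : check_quads L -> quads P L.
Proof.
move=> /allP h a b c d ab bc cd da ac bd.
move: h => /(_ a (check_V ab)) /allP /(_ b ab) /allP /(_ c bc) /allP /(_ d cd).
rewrite (negPf ac) (negPf bd) !orFb => /orP [|/hasP [s sL /andP [/allP s1 /allP s2]]].
  by rewrite [_ \notin _](negbF da).
exists s => // y; apply/idP/idP; [exact: s2|exact: s1].
Qed.

(** * Enumeration of the colourings and search for switches *)

Definition edges := [seq e <- [seq (x, y) | x <- V, y <- V] | (e.1 < e.2) && P e.1 e.2].

(* A colouring is encoded by the list of the colours of the edges in es. *)
Variable es : seq (nat * nat).
Hypothesis es_edges : es = edges.

Definition color (i : nat) : 'I_3 := nth (Ordinal (isT : 0 < 3))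
  [:: Ordinal (isT : 0 < 3); Ordinal (isT : 1 < 3); Ordinal (isT : 2 < 3)] i.
Definition colors := [:: color 0; color 1; color 2].

Lemma in_colors c : c \in colors.
Proof. by case: c => [[|[|[|]]]]. Qed.

Definition encode (c : ecol) := [seq c e.1 e.2 | e <- es].
Definition decode (s : seq 'I_3) : ecol := fun x y =>
  nth (color 0) s (index (if x < y then (x, y) else (y, x)) es).

Lemma mem_es x y : x < y -> P x y -> (x, y) \in es.
Proof.
move=> xy Pxy; rewrite es_edges mem_filter; apply/andP; split; first by rewrite /= xy.
by apply/allpairsP; exists (x, y); rewrite /= !mem_iota !add0n !ltnS (check_dom Pxy) (check_le Pxy).
Qed.

Lemma esE e : e \in es -> P e.1 e.2 /\ e.1 < e.2.
Proof. by rewrite es_edges mem_filter => /andP [/andP [? ?] _]. Qed.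

Lemma encodeK c x y : sym_col P c -> P x y -> decode (encode c) x y = c x y.
Proof.
move=> cs xy; rewrite /decode /encode; case: ltnP => xy'.
  by rewrite (nth_map (0, 0)) ?index_mem ?nth_index ?mem_es.
have yx' : y < x.
  by rewrite ltn_neqAle xy' andbT; apply/eqP => yx; rewrite yx check_irr in xy.
have yx : P y x by rewrite check_sym.
by rewrite (nth_map (0, 0)) ?index_mem ?nth_index ?mem_es //= cs.
Qed.

(* Adjacency at the vertex 0 is disregarded, so that the enumeration below also
   serves for the parity condition. *)
Definition conflict (e f : nat * nat) :=
  has (fun v => (0 < v) && (v \in [:: f.1; f.2])) [:: e.1; e.2].

(** Backtracking edge by edge, which avoids running through all lists of colours. [J] holds the
    earlier edges whose colours are excluded. *)
Fixpoint all_col k : seq (seq 'I_3) := if k is k'.+1 then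
    let J := [seq j <- iota 0 k' | conflict (nth (0, 0) es j) (nth (0, 0) es k')] in
    flatten [seq [seq rcons s x | x <- colors & all (fun j => nth (color 0) s j != x) J]
      | s <- all_col k']
  else [:: [::]].

Lemma encode_all_col c : sym_col P c -> (forall x, 0 < x -> proper_at P c x) ->
  encode c \in all_col (size es).
Proof.
move=> cs cp; rewrite /encode -[X in map _ X]take_size.
have: size es <= size es by [].
elim: {1 3 4}(size es) => [|k IH] ks; first by rewrite take0.
rewrite (take_nth (0, 0)) // map_rcons /all_col -/(all_col k).
apply/flattenP; eexists; first by apply: map_f; exact: (IH (ltnW ks)).
apply/mapP; eexists; last by reflexivity.
rewrite mem_filter in_colors andbT; apply/allP => j.
rewrite mem_filter mem_iota add0n => /andP [+ /andP [_ jk]].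
set e := nth _ es j; set f := nth _ es k => ef.
have js : j < size es by apply: ltn_trans ks.
rewrite (nth_map (0, 0)) ?size_take ?ks // nth_take // -/e.
have nef : e <> f.
  move/eqP; rewrite nth_uniq //; first by rewrite ltn_eqF.
  by rewrite es_edges filter_uniq // allpairs_uniq ?iota_uniq // => -[? ?] [? ?].
have [Pe e12] : P e.1 e.2 /\ e.1 < e.2 by apply: esE (mem_nth (0, 0) js).
have [Pf f12] : P f.1 f.2 /\ f.1 < f.2 by apply: esE (mem_nth (0, 0) ks).
have Pe' : P e.2 e.1 by rewrite check_sym.
have Pf' : P f.2 f.1 by rewrite check_sym.
have pairE : forall u v : nat * nat, u.1 = v.1 -> u.2 = v.2 -> u = v.
  by move=> [? ?] [? ?] /= -> ->.
(* Four cases, according to which end of each edge is the shared positive vertex; matching first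
   with second ends would contradict the orientation if the other ends also agreed. *)
move: ef; rewrite /conflict /= !inE orbF => /orP [] /andP [v0 /orP [] /eqP ve];
  apply/eqP.
- rewrite -ve; apply: cp => //; first by rewrite ve.
  by move=> h; apply: nef; apply: pairE.
- rewrite (cs f.1) // -ve; apply: cp => //; first by rewrite ve.
  by move=> h; move: e12; rewrite h ve ltnNge (ltnW f12).
- rewrite (cs e.1) // -ve; apply: cp => //; first by rewrite ve.
  by move=> h; move: e12; rewrite h ve ltnNge (ltnW f12).
- rewrite (cs e.1) // (cs f.1) // -ve; apply: cp => //; first by rewrite ve.
  by move=> h; apply: nef; apply: pairE.
Qed.

(* A cheap necessary condition, only there to speed up kempe_test. *)
Definition may_switch (ab : 'I_3 * 'I_3) (s s' : seq 'I_3) :=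
  all (fun p => (p.1 == p.2) || (swap_col ab.1 ab.2 p.1 == p.2)) (zip s s').

(** In a properly coloured cubic graph every switched vertex has an edge that changes colour. So the
    set to be switched need not be guessed: it consists of the ends of the edges on which the
    colourings differ. *)
Definition kempe_test (s s' : seq 'I_3) :=
  has (fun ab : 'I_3 * 'I_3 => if may_switch ab s s' then
    let X := flatten [seq [:: e.1; e.2] | e <- es & decode s e.1 e.2 != decode s' e.1 e.2] in
    (ab.1 != ab.2) && all (fun e =>
      let x := decode s e.1 e.2 in
      ((x == ab.1) || (x == ab.2) ==> ((e.1 \in X) == (e.2 \in X)))
      && (decode s' e.1 e.2 == if e.1 \in X then swap_col ab.1 ab.2 x else x)) es
    else false)
    [:: (color 0, color 1); (color 0, color 2); (color 1, color 2)].

Lemma es_either x y : P x y -> (x, y) \in es \/ (y, x) \in es.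
Proof.
move=> xy; case: (ltngtP x y) => [?|?|h]; last by rewrite h check_irr in xy.
  by left; apply: mem_es.
by right; apply: mem_es => //; rewrite check_sym.
Qed.

Lemma decode_sym s : sym_col P (decode s).
Proof.
move=> x y xy; rewrite /decode; case: (ltngtP x y) => // h.
by rewrite h check_irr in xy.
Qed.

(** Agreement at 0 means that no edge at 0 changes, which keeps 0 out of the switched set. *)
Lemma kempe_testP s s' : kempe_test s s' ->
    (forall y, P 0 y -> decode s 0 y = decode s' 0 y) ->
  keq P (pred1 0) (decode s) (decode s').
Proof.
move=> /hasP [[a b] _]; case: ifP => // _; set X := flatten _.
move=> /andP [/= ab /allP h] s0.
apply: (@keq_step _ _ a b (mem X) _ (decode s') (decode s')) => //.
- move=> x /eqP ->; apply/negP => /flattenP [v /mapP [e]].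
  rewrite mem_filter => /andP [ne /esE [Pe e12]] ->; rewrite !inE => /orP [] /eqP e0.
    by rewrite -e0 s0 ?eqxx // e0 in ne.
  by rewrite -e0 ltn0 in e12.
- move=> x y xy hc; case: (es_either xy) => /h /= /andP [+ _].
    by move/implyP => /(_ hc) /eqP.
  by rewrite -decode_sym // => /implyP /(_ hc) /eqP.
- move=> x y xy; case: (es_either xy) => /h /= /andP [+ /eqP]; first by [].
  rewrite -!(@decode_sym _ x y) // => /implyP hc ->.
  case: (boolP ((decode s x y == a) || (decode s x y == b))).
    by move/hc => /eqP ->.
  by move/swap_id ->; rewrite !if_same.
- exact: keq_eq.
Qed.

(** Each round adds the members of [L] one step away. The conditional spares call-by-value
    evaluation the tests on colourings already found. *)
Fixpoint closure (L R : seq (seq 'I_3)) k := if k is k'.+1 then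
    let R := closure L R k' in
    [seq s <- L | if s \in R then true else has (fun r => kempe_test r s) R]
  else R.

Definition normal (s : seq 'I_3) := all (fun y => decode s 0 y == color y.-1) [:: 1; 2; 3].

Lemma normalP s : reflect (forall y, P 0 y -> decode s 0 y = color y.-1) (normal s).
Proof.
apply: (iffP allP) => [h y|h y y3]; last first.
  by apply/eqP/h; rewrite check_first; move: y3; rewrite !inE; lia.
by rewrite check_first => y4; apply/eqP/h; rewrite !inE; lia.
Qed.

(** All colourings involved are normal, hence agree at 0, so every step found avoids 0. *)
Lemma closure_keq L s0 k s : {in L, forall s, normal s} -> normal s0 ->
    s \in closure L [:: s0] k ->
  keq P (pred1 0) (decode s0) (decode s) /\ normal s.
Proof.
move=> hL n0; elim: k s => [|k IH] s.
  by rewrite inE => /eqP ->; split=> //; apply: keq_eq.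
rewrite /closure -/(closure L [:: s0] k) mem_filter => /andP [+ sL].
case: ifP => [/IH //|_ /hasP [r /IH [k1 nr] rs]]; have ns := hL _ sL; split=> //.
apply: (keq_trans k1); apply: kempe_testP rs _ => y y0.
by rewrite (normalP _ nr) // (normalP _ ns).
Qed.

Let En := all_col (size es).

Definition check_parity := all (fun s =>
  all (fun y => all (fun z => (y == z) || (decode s 0 y != decode s 0 z))
    (nth [::] t 0)) (nth [::] t 0)) En.

Lemma check_parityP : check_parity -> forall c, sym_col P c ->
  (forall x, 0 < x -> proper_at P c x) -> proper_at P c 0.
Proof.
move=> /allP h c cs cp y z y0 z0 yz; rewrite -!(encodeK cs) //; apply/eqP.
have := h _ (encode_all_col cs cp) => /allP /(_ y y0) /allP /(_ z z0).
by case: eqP.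
Qed.

Definition check_kempe k := let L := [seq s <- En | normal s] in
  let R := closure L [:: head [::] L] k in all (fun s => s \in R) L.

(** Two colourings that agree at 0 are normalised by the same renaming of colours. The closure
    connects both to the first normal colouring, and the renaming is then undone. *)
Lemma check_kempeP k : check_kempe k ->
  forall c d, proper_col P c -> proper_col P d ->
    (forall y, P 0 y -> c 0 y = d 0 y) -> keq P (pred1 0) c d.
Proof.
rewrite /check_kempe; set L := filter _ _ => /allP h c d cp dp cd.
have P0 (i : 'I_3) : P 0 i.+1 by rewrite check_first /= (leq_ltn_trans (ltn_ord i)).
(* The colours at 0 form a permutation of the three colours; its inverse [g] is the renaming. *)
have gI : injective (fun i : 'I_3 => c 0 i.+1).
  move=> i j cij; apply/eqP; apply: contraTT isT => /eqP ij.
  have [_ /(_ 0)] := cp; move/(_ _ _ (P0 i) (P0 j)); case=> // -[] /val_inj; exact: ij.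
have [g gK Kg] := injF_bij gI.
have norm e : proper_col P e -> (forall y, P 0 y -> e 0 y = c 0 y) ->
    encode (fun x y => g (e x y)) \in L /\ sym_col P (fun x y => g (e x y)).
  move=> [es_ ep] ec; have ges : sym_col P (fun x y => g (e x y)) by move=> x y xy; rewrite es_.
  split=> //; rewrite mem_filter encode_all_col //; last first.
    by move=> x _ y z xy xz yz /(can_inj Kg); apply: ep.
  rewrite andbT; apply/normalP => y y0; rewrite encodeK // ec //.
  have y4 : y.-1 < 3 by move: y0; rewrite check_first; lia.
  rewrite [X in c 0 X](_ : y = (Ordinal y4).+1); last by move: y0 => /=; rewrite check_first; lia.
  by rewrite gK; apply: val_inj; case: (y.-1) y4 => [|[|[|]]].
have [cL gcs] := norm c cp (fun _ _ => erefl).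
have [dL gds] := norm d dp (fun y y0 => esym (cd y y0)).
have nL : {in L, forall s, normal s} by move=> s; rewrite mem_filter => /andP [].
have n0 : normal (head [::] L).
  by apply: nL; case: (L) cL => //= s L' _; rewrite mem_head.
have [kc _] := closure_keq nL n0 (h _ cL).
have [kd _] := closure_keq nL n0 (h _ dL).
have kcd : keq P (pred1 0) (fun x y => g (c x y)) (fun x y => g (d x y)).
  apply: (keq_ext (c' := decode (encode (fun x y => g (c x y))))).
    by move=> x y xy; rewrite encodeK.
  apply: keq_trans (keq_sym kc) _; apply: keq_trans kd (keq_eq _ _) => x y xy.
  by rewrite encodeK.
have := keq_recolor gI kcd.
move=> k'; apply: (keq_ext (c' := fun x y => c 0 (g (c x y)).+1)).
  by move=> x y _; rewrite Kg.
by apply: keq_trans k' (keq_eq _ _) => x y _; rewrite Kg.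
Qed.

Definition check_col (s : seq 'I_3) :=
  [&& all (fun x => all (fun y => all (fun z =>
    (y == z) || (decode s x y != decode s x z)) (nth [::] t x)) (nth [::] t x)) V,
    all (fun x => x == m - 3 + decode s x m) (nth [::] t m)
  & all (fun y => y == (decode s 0 y).+1) (nth [::] t 0)].

Lemma check_colP s : check_col s -> exists c, [/\ proper_col P c,
  forall x, P x m -> x = m - 3 + c x m & forall y, P 0 y -> y = (c 0 y).+1].
Proof.
case/and3P=> /allP h1 /allP h2 /allP h3; exists (decode s); split.
- split=> [|x y z xy xz yz]; first exact: decode_sym.
  have := h1 x (check_V xy) => /allP /(_ y xy) /allP /(_ z xz).
  by case: eqP => //= _ /eqP.
- by move=> x; rewrite check_sym => /h2 /eqP.
- by move=> y /h3 /eqP.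
Qed.

Lemma check_all k side s : check_bip side -> check_conn -> check_parity ->
  check_kempe k -> check_col s -> gadget m P.
Proof.
move=> hb hc hp hk hs.
have [c [cp cm c0]] := check_colP hs; split.
- split; [exact: check_size_ge|exact: check_sym|exact: check_irr|exact: check_le
    |exact: check_last|exact: check_cubic|exact: check_bipP hb|exact: check_connP|].
  by exists c.
- exact: check_first.
- exact: check_parityP.
- exact: (check_kempeP hk).
- by exists c.
Qed.

End Checks.

(** * The Franklin graph, the cube and their chains *)

Definition franklin := [:: [:: 1; 2; 3]; [:: 0; 4; 8]; [:: 0; 5; 8]; [:: 0; 9; 10];
  [:: 1; 6; 7]; [:: 2; 6; 7]; [:: 4; 5; 9]; [:: 4; 5; 10]; [:: 1; 2; 11];
  [:: 3; 6; 11]; [:: 3; 7; 11]; [:: 8; 9; 10]].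
Definition cube := [:: [:: 1; 2; 3]; [:: 0; 4; 5]; [:: 0; 4; 6]; [:: 0; 5; 6];
  [:: 1; 2; 7]; [:: 1; 3; 7]; [:: 2; 3; 7]; [:: 4; 5; 6]].

Definition franklin_edges := Eval vm_compute in edges 11 franklin.
Definition cube_edges := Eval vm_compute in edges 7 cube.

Lemma franklin_simple : check_simple 11 franklin. Proof. by vm_compute. Qed.
Lemma cube_simple : check_simple 7 cube. Proof. by vm_compute. Qed.

Lemma franklin_gadget : gadget 11 (adj_of franklin).
Proof.
(* The data are the number of rounds of [closure], a bipartition, and a normalised colouring in the
   order of [franklin_edges]. *)
apply: (@check_all 11 franklin franklin_simple franklin_edges _ 3
  [:: false; true; true; true; false; false; true; true; false; false; false; true]
  (map color [:: 0; 1; 2; 2; 1; 0; 2; 0; 1; 0; 1; 1; 2; 2; 0; 0; 1; 2])); by vm_compute.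
Qed.

Lemma cube_gadget : gadget 7 (adj_of cube).
Proof.
apply: (@check_all 7 cube cube_simple cube_edges _ 2
  [:: false; true; true; true; false; false; false; true]
  (map color [:: 0; 1; 2; 1; 2; 2; 0; 0; 1; 0; 1; 2])); by vm_compute.
Qed.

Lemma franklin_quads :
  quads (adj_of franklin) [:: [:: 0; 1; 2; 8]; [:: 4; 5; 6; 7]; [:: 3; 9; 10; 11]].
Proof. by apply: (check_quadsP franklin_simple); vm_compute. Qed.

Lemma cube_quads : quads (adj_of cube)
  [:: [:: 0; 1; 2; 4]; [:: 0; 1; 3; 5]; [:: 0; 2; 3; 6];
      [:: 1; 4; 5; 7]; [:: 2; 4; 6; 7]; [:: 3; 5; 6; 7]].
Proof. by apply: (check_quadsP cube_simple); vm_compute. Qed.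

Definition chain (M p q : nat) :=
  exists E, [/\ cubic3 M E, kempe1 E & few_quads M E p q].

Lemma chain_franklin : chain 11 2 3.
Proof.
exists (adj_of franklin); split; first exact: gadget_cubic3 franklin_gadget.
  exact: gadget_kempe1 franklin_gadget.
exists [:: [:: 0; 1; 2; 8]; [:: 4; 5; 6; 7]; [:: 3; 9; 10; 11]]; split=> //.
exact: franklin_quads.
Qed.

(** Of the three 4-cycles of the Franklin graph one contains 0, one contains 11 and one contains
    neither: two survive the deletion of 0, and one of these avoids the new last vertex. *)
Lemma chain_add_franklin M p q : chain M p q -> chain (M + 10) (p + 1) (p + 2).
Proof.
move=> [E [gE kE qE]]; exists (glue M E (adj_of franklin)); split.
- exact: glue_cubic3 gE franklin_gadget.
- exact: glue_kempe gE franklin_gadget kE.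
- by apply: (glue_quads gE franklin_gadget qE franklin_quads).
Qed.

(** 0 and 7 are opposite vertices, so each face of the cube contains exactly one of them: three
    survive, all at the new last vertex. *)
Lemma chain_add_cube M p q : chain M p q -> chain (M + 6) p (p + 3).
Proof.
move=> [E [gE kE qE]]; exists (glue M E (adj_of cube)); split.
- exact: glue_cubic3 gE cube_gadget.
- exact: glue_kempe gE cube_gadget kE.
- by rewrite -[X in few_quads _ _ X]addn0; apply: (glue_quads gE cube_gadget qE cube_quads).
Qed.

(** Each further cube destroys the three 4-cycles of the preceding one, so the total stays at
    [p + 3]; this needs at least one cube. *)
Lemma chain_add_cubes n M p q : chain M p q -> 0 < n -> chain (M + 6 * n) p (p + 3).
Proof.
move=> h; elim: n => // [[|n] IH] _; first by rewrite muln1; apply: chain_add_cube h.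
by rewrite mulnS [6 + _]addnC addnA; apply: chain_add_cube (IH _).
Qed.

(* Five cubes weigh as much as three Franklin graphs, so the number of the latter
   is taken to be 1, 2 or 3 according to k modulo 3. *)
Lemma chain_exists k : 0 < k -> exists E p,
  [/\ cubic3 (1 + 10 * k) E, kempe1 E & few_quads (1 + 10 * k) E p 5].
Proof.
(* The chain will consist of a Franklin graph, then [5 * j] cubes, then [r] more Franklin graphs. *)
move=> k0; pose j := k.-1 %/ 3; pose r := k.-1 %% 3.
have kE : k = 1 + j * 3 + r by rewrite /j /r -addnA -divn_eq; lia.
have r3 : r < 3 by rewrite ltn_mod.
suff [p [q [q5 [E [h1 h2 [L [h3 h4 h5]]]]]]] : exists p q, q <= 5 /\ chain (1 + 10 * k) p q.
  by exists E, p; split=> //; exists L; split=> //; apply: leq_trans q5.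
have [q [q5 c]] : exists q, q <= 5 /\ chain (11 + 6 * (5 * j)) 2 q.
  case: (posnP j) => [->|j0]; first by exists 3; split=> //; apply: chain_franklin.
  by exists 5; split=> //; apply: chain_add_cubes chain_franklin _; lia.
(* The Franklin graphs come last because each one resets the total to [p + 2], giving 4 for [r = 1]
   and 5 for [r = 2]. *)
case: r r3 kE => [|[|[|//]]] _ kE.
- by exists 2, q; rewrite (_ : 1 + 10 * k = 11 + 6 * (5 * j)); [split|lia].
- exists 3, 4; rewrite (_ : 1 + 10 * k = 11 + 6 * (5 * j) + 10); last by lia.
  by split=> //; apply: chain_add_franklin c.
exists 4, 5; rewrite (_ : 1 + 10 * k = 11 + 6 * (5 * j) + 10 + 10); last by lia.
by split=> //; apply: chain_add_franklin (chain_add_franklin c).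
Qed.

(** * Transfer to finite types *)

Section EdgeSwitch.
Variables (T : finType) (e : rel T).
Implicit Types (c : coloring e) (a b : 'I_3) (Y : pred (edge e)).

Definition switch_on c a b Y : coloring e :=
  [ffun g => if Y g then swap_col a b (c g) else c g].

Lemma adjacent_sym : symmetric (@adjacent_edges T e).
Proof.
move=> f g; rewrite /adjacent_edges eq_sym; congr (_ && _).
by apply: eq_existsb => v; rewrite andbC.
Qed.

Lemma ab_rel_sym c a b : symmetric (ab_rel c a b).
Proof.
move=> f g; rewrite /ab_rel /= adjacent_sym.
by case: adjacent_edges => //=; rewrite andbC.
Qed.

Lemma swap_in a b x : (swap_col a b x \in [:: a; b]) = (x \in [:: a; b]).
Proof.
rewrite /swap_col !inE; case: (eqVneq x a) => [_|xa]; first by rewrite eqxx orbT.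
by case: (eqVneq x b) => [_|xb]; rewrite ?eqxx // (negPf xa) (negPf xb).
Qed.

Lemma switch_on_in c a b Y g : (switch_on c a b Y g \in [:: a; b]) = (c g \in [:: a; b]).
Proof. by rewrite ffunE; case: (Y g); rewrite ?swap_in. Qed.

Lemma switch_on_out c a b Y g : c g \notin [:: a; b] -> switch_on c a b Y g = c g.
Proof. by rewrite ffunE !inE => /swap_id ->; rewrite if_same. Qed.

Lemma switch_on_proper c a b Y :
    (forall f g, ab_rel c a b f g -> Y f = Y g) ->
  proper3 c -> proper3 (switch_on c a b Y).
Proof.
move=> Yc cp; apply/'forall_forallP => f g; apply/implyP => fg.
have cfg : c f != c g by have /'forall_forallP /(_ f g) /implyP := cp; apply.
case: (boolP (c f \in [:: a; b])) => cf; last first.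
  apply: contra cfg => /eqP; rewrite (switch_on_out _ cf) => h.
  by rewrite h switch_on_out // -(switch_on_in _ _ _ Y) -h.
case: (boolP (c g \in [:: a; b])) => cg; last first.
  apply: contra cfg => /eqP; rewrite (switch_on_out _ cg) => h.
  by rewrite -h switch_on_out // -(switch_on_in _ _ _ Y) h.
have YE : Y f = Y g by apply: Yc; rewrite /ab_rel /= fg cf cg.
by rewrite !ffunE YE; case: (Y g) => //; rewrite (inj_eq (can_inj (swapK a b))).
Qed.

(** Induction on the number of edges of [Y] coloured [a] or [b]: the chain [Z] of one of them lies
    in [Y] and is switched first. This leaves the a/b-chains unchanged, and [Y] without [Z]
    remains. *)
Lemma switch_on_kempe c a b Y : a != b ->
    (forall f g, ab_rel c a b f g -> Y f = Y g) ->
  proper3 c -> kempe_equiv c (switch_on c a b Y).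
Proof.
move=> ab; move: {2}_.+1 (ltnSn #|[pred g | Y g && (c g \in [:: a; b])]|) => n.
elim: n c Y => // n IH c Y cn Yc cp.
case: (pickP [pred g | Y g && (c g \in [:: a; b])]) => [f0 /andP [Yf0 cf0]|none]; last first.
  rewrite (_ : switch_on _ _ _ _ = c); first exact: connect0.
  apply/ffunP => g; rewrite ffunE; case: ifP => // Yg; apply: swap_id.
  by have /= := none g; rewrite Yg !inE /= => ->.
pose c1 := kempe_switch c f0 a b; pose Z := in_chain c a b f0.
have Zc f g : ab_rel c a b f g -> Z f = Z g.
  move=> fg; rewrite /Z /in_chain cf0 /=.
  exact: same_connect_r (sym_connect_sym (ab_rel_sym c a b)) _ _ (connect1 fg) f0.
have c1E : c1 = switch_on c a b Z by [].
have c1p : proper3 c1 by rewrite c1E switch_on_proper.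
have ZY g : Z g -> Y g.
  rewrite /Z /in_chain cf0 /= => f0g.
  have Ycl : closed (ab_rel c a b) Y by move=> u v /Yc.
  by have := closed_connect Ycl f0g; rewrite !unfold_in => <-.
have rel1 f g : ab_rel c1 a b f g = ab_rel c a b f g by rewrite /ab_rel /= c1E !switch_on_in.
pose Y1 g := Y g && ~~ Z g.
have step : kempe_equiv c c1.
  apply: connect1; rewrite /= /kempe_step cp c1p /=; apply/orP; left.
  by apply/existsP; exists f0; apply/existsP; exists a; apply/existsP; exists b; rewrite ab eqxx.
have -> : switch_on c a b Y = switch_on c1 a b Y1.
  apply/ffunP => g; rewrite !ffunE /Y1 -/(Z g).
  case: (boolP (Z g)) => [/ZY ->|]; last by rewrite andbT.
  by [].
apply: (connect_trans step); apply: IH => //; last first.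
  by move=> f g; rewrite rel1 /Y1 => fg; rewrite (Yc _ _ fg) (Zc _ _ fg).
apply: leq_trans (_ : #|[pred g | Y g && (c g \in [:: a; b])]| <= n); last by rewrite -ltnS.
apply: proper_card; apply/properP; split.
  apply/subsetP => g /andP [/andP [Yg _] cg]; apply/andP; split=> //.
  by rewrite -(switch_on_in c a b Z).
exists f0; first by apply/andP.
by apply/negP => /andP [/andP [_]]; rewrite /Z /in_chain cf0 connect0.
Qed.

Lemma kempe_equiv_sym : symmetric (@kempe_equiv T e).
Proof. by apply: sym_connect_sym => c d /=; rewrite orbC. Qed.

Lemma Kprime3_eq1 c0 : proper3 c0 ->
  (forall c : coloring e, proper3 c -> kempe_equiv c0 c) -> Kprime3 e = 1.
Proof.
move=> c0p h; rewrite /Kprime3.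
rewrite (_ : [set _ | _ in _] = [set [set c' | kempe_equiv c0 c']]) ?cards1 //.
apply/setP => A; rewrite !inE; apply/imsetP/eqP => [[c]|->]; last first.
  by exists c0; rewrite ?inE.
rewrite inE => /h cc ->; apply/setP => d; rewrite !inE.
rewrite /kempe_equiv (same_connect _ cc) //.
exact: kempe_equiv_sym.
Qed.

End EdgeSwitch.

(** * From graphs on numbers to graphs on ordinals *)

Section Transfer.
Variables (M : nat) (E : rel nat).
Hypothesis gE : cubic3 M E.

Definition ord_graph : rel 'I_M.+1 := [rel x y : 'I_M.+1 | E x y].
Let e := ord_graph.

Let e_sym : symmetric e.
Proof. by move=> x y; rewrite /e /ord_graph /= (adj_sym gE). Qed.

Lemma ord_simple : simple_graph e.
Proof. by split=> // x; rewrite /e /ord_graph /= (adj_irr gE). Qed.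

Lemma ord_cubic : cubic e.
Proof.
move=> v; have [|s [us <- hs]] := adj_cubic gE (x := v); first by rewrite -ltnS.
rewrite cardE -(size_map val); apply: perm_size; apply: uniq_perm => //.
  by rewrite (map_inj_uniq val_inj) enum_uniq.
move=> y; apply/mapP/idP => [[u]|]; first by rewrite mem_enum inE /e /ord_graph /= hs => ? ->.
rewrite -hs => vy; have yM := adj_le gE vy.
by exists (inord y); rewrite ?mem_enum ?inE /e /ord_graph /= inordK.
Qed.

Lemma ord_bipartite : bipartite e.
Proof. by have [side h] := adj_bip gE; exists (fun x => side (val x)) => u v /h. Qed.

Lemma ord_connect s t (D : pred 'I_M.+1) : (forall x : 'I_M.+1, D x = avoid s t x) ->
  forall x y, D x -> D y -> connect [rel a b | e a b && (a \in D) && (b \in D)] x y.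
Proof.
move=> hD x y Dx Dy; have xM : x <= M by rewrite -ltnS.
have yM : y <= M by rewrite -ltnS.
have ax : avoid s t x by rewrite -hD.
have ay : avoid s t y by rewrite -hD.
have := adj_conn gE xM yM ax ay; rewrite -{2}(inord_val y).
elim=> [|u v xu IH uv av]; first by rewrite inord_val connect0.
have vM := adj_le gE uv; have uM : u <= M.
  by apply: (@adj_le _ _ gE v); rewrite (adj_sym gE).
apply: connect_trans IH (connect1 _).
by rewrite /= /e /ord_graph /= !inordK // uv !unfold_in !hD !inordK // av (reach_in ax xu).
Qed.

Lemma ord_three_connected : three_connected e.
Proof.
split; first by rewrite card_ord; have := size_ge gE; lia.
move=> S S3.
have [s [t hS]] : exists s t, forall x : 'I_M.+1, (x \in ~: S) = avoid s t x.
  case: (ltngtP #|S| 1) S3 => [S0 _|S2 S3|/eqP /cards1P [s ->] _].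
  - exists M.+1, M.+1 => x; move: S0; rewrite ltnS leqn0 cards_eq0 => /eqP ->.
    by rewrite !inE /avoid /= (ltn_eqF (ltn_ord x)).
  - have/cards2P [s [t [_ ->]]] : #|S| == 2 by rewrite eqn_leq -ltnS S3.
    by exists (val s), (val t) => x; rewrite !inE /avoid negb_or.
  - by exists (val s), (val s) => x; rewrite !inE /avoid andbb.
by move=> x y; apply: (ord_connect hS).
Qed.

Lemma edge_endsP (g : edge e) : exists p : 'I_M.+1 * 'I_M.+1,
  e p.1 p.2 && (val g == [set p.1; p.2]).
Proof. by case/existsP: (valP g) => x /existsP [y h]; exists (x, y). Qed.

(** Edges are unordered sets; the chosen order is immaterial for symmetric colourings. *)
Definition ends g := xchoose (edge_endsP g).

Lemma endsP g : e (ends g).1 (ends g).2 /\ val g = [set (ends g).1; (ends g).2].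
Proof. by have /andP [? /eqP] := xchooseP (edge_endsP g). Qed.

Definition to_edges (f : ecol) : coloring e := [ffun g => f (ends g).1 (ends g).2].

Lemma to_edgesE f (g : edge e) v : sym_col E f -> v \in val g ->
  exists u, [/\ e v u, val g = [set v; u] & to_edges f g = f v u].
Proof.
move=> fs; have [eg ->] := endsP g; rewrite !inE ffunE => /orP [] /eqP ->.
  by exists (ends g).2.
by exists (ends g).1; rewrite e_sym setUC fs.
Qed.

Lemma to_edges_proper f : proper_col E f -> proper3 (to_edges f).
Proof.
move=> [fs fp]; apply/'forall_forallP => g h; apply/implyP => /andP [gh /existsP [v /andP [vg vh]]].
have [u [vu gE' ->]] := to_edgesE fs vg; have [w [vw hE ->]] := to_edgesE fs vh.
apply/eqP; apply: fp => // uw; move/eqP: gh; apply; apply: val_inj.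
by rewrite gE' hE (val_inj uw).
Qed.

(** The vertex set [X] becomes the set of edges whose chosen first end lies in [X]. For edges
    coloured [a] or [b] either end would do, so this set is closed under a/b-adjacency. *)
Lemma keq_kempe f f' : keq E pred0 f f' -> proper_col E f ->
  kempe_equiv (to_edges f) (to_edges f').
Proof.
elim=> {f f'} [f f' h _|a b X f f' d ab _ Xc h _ IH fp].
  rewrite (_ : to_edges f = to_edges f'); first exact: connect0.
  by apply/ffunP => g; rewrite !ffunE h //; case: (endsP g).
apply: connect_trans (IH (step_proper (adj_sym gE) Xc h fp)).
have [fs _] := fp.
have -> : to_edges f' = switch_on (to_edges f) a b (fun g => X (ends g).1).
  by apply/ffunP => g; rewrite !ffunE h //; case: (endsP g).
have Xv (g : edge e) v : v \in val g -> to_edges f g \in [:: a; b] -> X v = X (ends g).1.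
  move=> vg; have [u [vu gE' ->]] := to_edgesE fs vg; rewrite !inE => /(Xc _ _ vu) Xvu.
  have : (ends g).1 \in val g by have [_ ->] := endsP g; rewrite !inE eqxx.
  by rewrite gE' !inE => /orP [] /eqP ->.
apply: switch_on_kempe => //; last exact: to_edges_proper.
move=> g h'; rewrite /ab_rel /= => /andP [/andP [/andP [_ /existsP [v /andP [vg vh]]] gab] hab].
by rewrite -(Xv g v) // (Xv h' v).
Qed.

Definition of_edges (c : coloring e) : ecol := fun x y =>
  odflt ord0 (omap c (insub [set inord x; inord y])).

Lemma of_edgesE (c : coloring e) (x y : 'I_M.+1) (g : edge e) :
  val g = [set x; y] -> of_edges c x y = c g.
Proof. by move=> gE'; rewrite /of_edges !inord_val -gE' valK. Qed.

Lemma of_edgesK c : to_edges (of_edges c) = c.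
Proof. by apply/ffunP => g; rewrite ffunE; apply: of_edgesE; case: (endsP g). Qed.

Lemma edge_of (x y : 'I_M.+1) : e x y -> exists g : edge e, val g = [set x; y].
Proof.
move=> xy; have h : [exists x', exists y', e x' y' && ([set x; y] == [set x'; y'])].
  by apply/existsP; exists x; apply/existsP; exists y; rewrite xy eqxx.
by exists (exist (fun s : {set 'I_M.+1} => [exists x, exists y, e x y && (s == [set x; y])]) _ h).
Qed.

Lemma of_edges_proper c : proper3 c -> proper_col E (of_edges c).
Proof.
move=> cp; split=> [x y _|x y z xy xz yz]; first by rewrite /of_edges setUC.
have xM : x <= M by apply: (@adj_le _ _ gE y); rewrite (adj_sym gE).
have yM := adj_le gE xy; have zM := adj_le gE xz.
rewrite -(inordK (xM : x < M.+1)) -(inordK (yM : y < M.+1)) -(inordK (zM : z < M.+1)).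
have [g gE'] : exists g : edge e, val g = [set inord x; inord y].
  by apply: edge_of; rewrite /e /ord_graph /= !inordK.
have [h hE] : exists g : edge e, val g = [set inord x; inord z].
  by apply: edge_of; rewrite /e /ord_graph /= !inordK.
rewrite (of_edgesE _ gE') (of_edgesE _ hE); apply/eqP.
have /'forall_forallP /(_ g h) /implyP := cp; apply; apply/andP; split; last first.
  by apply/existsP; exists (inord x); rewrite gE' hE !inE eqxx.
apply/eqP => gh; have : inord y \in val h by rewrite -gh gE' !inE eqxx orbT.
have xyne : inord y != inord x :> 'I_M.+1.
  by rewrite -val_eqE /= !inordK //; apply/eqP => yx; rewrite yx (adj_irr gE) in xy.
rewrite hE !inE (negPf xyne) /= -val_eqE /= !inordK // => /eqP; exact: yz.
Qed.

Lemma ord_Kprime3 : kempe1 E -> Kprime3 e = 1.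
Proof.
move=> kE; have [c0 [c0p _]] := adj_col gE.
apply: (@Kprime3_eq1 _ _ (to_edges c0)); first exact: to_edges_proper.
move=> c cp; rewrite -(of_edgesK c); apply: keq_kempe => //.
exact: kE _ _ c0p (of_edges_proper cp).
Qed.

End Transfer.

(** * Nonplanarity *)

Section Nonplanar.
Variables (T : finType) (e : rel T).
Hypotheses (e_simple : simple_graph e) (e_cubic : cubic e) (e_bip : bipartite e)
  (e_conn : three_connected e).

Let e_sym : symmetric e := e_simple.1.
Let e_irr : irreflexive e := e_simple.2.

Let dart_adj (d : dart e) : e (val d).1 (val d).2.
Proof. by have /andP [] := valP d. Qed.

Let dart_of x y : e x y -> exists d : dart e, val d = (x, y).
Proof.
move=> xy; have h : e (x, y).1 (x, y).2 && e (x, y).2 (x, y).1 by rewrite /= (e_sym y) xy.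
by exists (exist (fun d : T * T => e d.1 d.2 && e d.2 d.1) _ h).
Qed.

Lemma card_dart : #|{: dart e}| = 3 * #|T|.
Proof.
rewrite card_sig mulnC -sum_nat_const -sum1_card (eq_bigl (fun p => predT p.1 && e p.1 p.2)).
  rewrite -(pair_big_dep predT (fun x y => e x y) (fun _ _ => 1)) /=.
  by apply: eq_bigr => x _; rewrite -(e_cubic x) -sum1_card; apply: eq_bigl => y; rewrite inE.
by move=> p; rewrite unfold_in /= (e_sym p.2) andbb.
Qed.

(** * Faces of a rotation system *)

Section Rotation.
Variable sigma : {perm dart e}.
Hypothesis rot : rotation_system sigma.

Let sigma_src d : (val (sigma d)).1 = (val d).1 := rot.1 d.

Let phi d := sigma (drev d).

Let drevK : involutive (@drev T e).
Proof. by move=> d; apply: val_inj => /=; case: (val d). Qed.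

Let phi_inj : injective phi.
Proof. by move=> d d' /perm_inj /(can_inj drevK). Qed.

Let phi_src d : (val (phi d)).1 = (val d).2.
Proof. by rewrite sigma_src. Qed.

(** Otherwise the orbit of [d], which contains all three darts at its vertex, would have at most two
    elements. *)
Let sigma2 d : sigma (sigma d) != d.
Proof.
apply/eqP => h.
have dd' d' : (val d').1 = (val d).1 -> (d' == d) || (d' == sigma d).
  move=> /esym /(rot.2 d d').
  have cl : fclosed sigma [pred x | (x == d) || (x == sigma d)].
    move=> x _ /eqP <- /=; rewrite !inE (inj_eq perm_inj) orbC.
    by rewrite -{3}h (inj_eq perm_inj).
  by move/(closed_connect cl); rewrite !inE eqxx.
have: #|[set u | e (val d).1 u]| <= #|[set (val d).2; (val (sigma d)).2]|.
  apply/subset_leq_card/subsetP => u; rewrite !inE => /dart_of [d' d'E].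
  have /dd' : (val d').1 = (val d).1 by rewrite d'E.
  by case/orP=> /eqP <-; rewrite d'E eqxx ?orbT.
by rewrite e_cubic cards2; case: (_ != _).
Qed.

Let sigma1 d : sigma d != d.
Proof. by apply: contra (sigma2 d) => /eqP h; rewrite !h. Qed.

(** Backtracking means [phi d = drev d], a fixed point of [sigma]. *)
Let no_backtrack d : (val (phi d)).2 != (val d).1.
Proof.
apply: contra (sigma1 (drev d)) => /eqP h; apply/eqP; apply: val_inj.
by rewrite -/(phi d) [LHS]surjective_pairing h phi_src.
Qed.

(** Each step along a face changes the side of the bipartition. *)
Let order_even d : ~~ odd (fingraph.order phi d).
Proof.
have [side hs] := e_bip.
have flip n : side (val (iter n phi d)).1 = side (val d).1 (+) odd n.
  elim: n => [|n IH]; first by rewrite addbF.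
  rewrite iterS phi_src /= addbN -IH; have := hs _ _ (dart_adj (iter n phi d)).
  by case: (side _); case: (side _).
have := flip (fingraph.order phi d); rewrite iter_order //.
by case: (side _); case: odd.
Qed.

Let order_ge4 d : 4 <= fingraph.order phi d.
Proof.
have := order_even d; have := iter_order phi_inj d; have := fingraph.order_gt0 phi d.
case: (fingraph.order phi d) => [|[|[|[|n]]]] //= _ h _.
by have := no_backtrack d; rewrite -phi_src h eqxx.
Qed.

Let face d := [set d' | fconnect phi d d'].
Let faces := [set face d | d : dart e].

Let card_face d : #|face d| = fingraph.order phi d.
Proof. by rewrite cardsE. Qed.

Let sum_faces : \sum_(f in faces) #|f| = 3 * #|T|.
Proof.
rewrite -card_dart -cardsT; apply/esym/card_partition.
have -> : faces = equivalence_partition (fconnect phi) [set: dart e].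
  rewrite /faces /equivalence_partition /face.
  apply/setP => A; apply/imsetP/imsetP => -[d _ ->]; exists d; rewrite ?inE //;
    by apply/setP => y; rewrite !inE.
apply: equivalence_partitionP => x y z _ _ _; split; first exact: connect0.
by move=> xy; apply: same_connect xy _; apply: fconnect_sym.
Qed.

(** The last clause identifies the predecessor of [d] on its face; it serves to compare two faces
    running in opposite directions. *)
Let quad_face d : fingraph.order phi d = 4 -> let a := (val d).1 in let b := (val d).2 in
  exists c w, [/\ [/\ e a b, e b c, e c w & e w a], a != c, b != w &
    [/\ forall x, x \in [:: a; b; c; w] -> exists2 d', d' \in face d & (val d').1 = x,
        forall d', d' \in face d -> (val d').1 \in [:: a; b; c; w]
      & forall d', val d' = (w, a) -> phi d' = d]].
Proof.
move=> o4 a b; pose d1 := phi d; pose d2 := phi d1; pose d3 := phi d2.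
have d4 : phi d3 = d by have := iter_order phi_inj d; rewrite o4.
have s1 : (val d1).1 = b by rewrite phi_src.
have s2 : (val d1).2 = (val d2).1 by rewrite phi_src.
have s3 : (val d2).2 = (val d3).1 by rewrite phi_src.
have s4 : (val d3).2 = a by rewrite -phi_src d4.
exists (val d2).1, (val d3).1; split.
- split; first exact: dart_adj.
  + by rewrite -s1 -s2; apply: dart_adj.
  + by rewrite -s3; apply: dart_adj.
  + by rewrite -s4; apply: dart_adj.
- by have := no_backtrack d; rewrite -/d1 s2 eq_sym.
- by have := no_backtrack d1; rewrite -/d2 s3 s1 eq_sym.
have faceE d' : (d' \in face d) = (d' \in [:: d; d1; d2; d3]).
  by rewrite inE fconnect_orbit /orbit o4.
split.
- move=> x; rewrite !inE => /or4P [] /eqP ->; [exists d|exists d1|exists d2|exists d3] => //;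
    by rewrite faceE !inE eqxx ?orbT.
- by move=> d'; rewrite faceE !inE => /or4P [] /eqP ->; rewrite ?s1 eqxx ?orbT.
- move=> d' d'E; rewrite -d4; congr phi; apply: val_inj.
  by rewrite d'E -s4 -surjective_pairing.
Qed.

Let vertices (f : {set dart e}) := [set (val d).1 | d in f].

Let vertices_face d a b c w :
    (forall x, x \in [:: a; b; c; w] -> exists2 d', d' \in face d & (val d').1 = x) ->
    (forall d', d' \in face d -> (val d').1 \in [:: a; b; c; w]) ->
  vertices (face d) =i [:: a; b; c; w].
Proof.
move=> h1 h2 x; apply/imsetP/idP => [[d' /h2 + ->] //|/h1 [d' ? <-]]; by exists d'.
Qed.

Let face_eq d d' : d' \in face d -> face d' = face d.
Proof.
rewrite inE => dd'; apply/setP => x; rewrite !inE.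
exact/esym/(same_connect (fconnect_sym phi_inj) dd').
Qed.

(* Two faces running through the same 4-cycle in opposite directions would make
   sigma exchange two darts, but its orbits have three elements. *)
Let vertices_inj : {in [set f in faces | #|f| == 4] &, injective vertices}.
Proof.
move=> f f'; rewrite !inE => /andP [/imsetP [d0 _ ->] f4] /andP [/imsetP [d' _ ->] f'4] V.
move: f'4 f4; rewrite card_face => /eqP o'4.
have [c' [w' [[ab' bc' cw' wa'] ac' bw' [h1' h2' h3']]]] := quad_face o'4.
have V' := vertices_face h1' h2'.
have: (val d').1 \in vertices (face d0) by rewrite V V' mem_head.
case/imsetP=> d /face_eq fE aE; rewrite -fE in V *; rewrite card_face => /eqP o4.
have [c [w [[ab bc cw wa] ac bw [h1 h2 h3]]]] := quad_face o4.
have V1 := vertices_face h1 h2.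
have [side hs] := e_bip.
rewrite -aE in ab wa ac h1 h2 h3 V1.
set a := (val d').1 in aE ab wa ac h1 h2 h3 V1 ab' wa' ac' h1' h2' h3' V'.
(* Within the 4-cycle only the two cyclic neighbours can be adjacent to [a], as the opposite vertex
   is on the same side. *)
have nb x : e a x -> x \in [:: a; (val d).2; c; w] -> (x == (val d).2) || (x == w).
  move=> ax; rewrite !inE => /or4P [/eqP xa|->//|/eqP xc|->]; last by rewrite orbT.
    by rewrite xa e_irr in ax.
  move: (hs _ _ ax) (hs _ _ ab) (hs _ _ bc); rewrite xc.
  by case: (side a); case: (side c); case: (side _).
have bE : (val d').2 \in [:: a; (val d).2; c; w].
  by rewrite -V1 V V' !inE eqxx orbT.
have wE : w' \in [:: a; (val d).2; c; w].
  by rewrite -V1 V V' !inE eqxx !orbT.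
have same : val d' = val d -> face d = face d' by move/val_inj ->.
case/orP: (nb _ ab' bE) => /eqP b'E.
  by apply: same; rewrite [LHS]surjective_pairing [RHS]surjective_pairing b'E -aE.
rewrite e_sym in wa'; case/orP: (nb _ wa' wE) => /eqP w'E; last first.
  by rewrite b'E w'E eqxx in bw'.
(* The cycles are now opposite, so [drev d] is the dart that precedes [d'] on the other face. *)
have s1 : sigma d = d'.
  rewrite -(h3' (drev d)) /phi ?drevK //=.
  by rewrite w'E -aE.
have s2 : sigma d' = d.
  rewrite -(h3 (drev d')) /phi ?drevK //=.
  by rewrite b'E.
by have := sigma2 d; rewrite s1 s2 eqxx.
Qed.

(** With V vertices, F faces and at most five faces of length 4, summing face lengths gives 6F <= 3V
    + 10. As V is even, F < V/2 + 2, while the number of edges is 3V/2. *)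
Lemma nonplanar_rotation (L : seq {set T}) : size L < 6 -> ~~ odd #|T| ->
    (forall a b c d, e a b -> e b c -> e c d -> e d a -> a != c -> b != d ->
       exists2 s, s \in L & s =i [:: a; b; c; d]) ->
  #|T| + num_faces sigma < 2 + num_edges e.
Proof.
move=> L6 evT hL; pose F4 := [set f in faces | #|f| == 4].
have F4L : #|F4| <= size L.
  rewrite -(card_in_imset vertices_inj) cardE; apply: uniq_leq_size (enum_uniq _) _ => A.
  rewrite mem_enum => /imsetP [f]; rewrite inE => /andP [/imsetP [d _ ->]].
  rewrite card_face => /eqP o4 ->.
  have [c [w [[ab bc cw wa] ac bw [h1 h2 _]]]] := quad_face o4.
  have [s sL sE] := hL _ _ _ _ ab bc cw wa ac bw.
  rewrite (_ : vertices _ = s) //; apply/setP => x.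
  by rewrite sE (vertices_face h1 h2).
(* Lengths are even and at least 4, so a face of length 4 falls short of 6 by 2 and no other face
   falls short. *)
have sum6 : 6 * #|faces| <= 3 * #|T| + 2 * #|F4|.
  rewrite -sum_faces mulnC -sum_nat_const.
  have -> : 2 * #|F4| = \sum_(f in faces) 2 * (#|f| == 4).
    rewrite -big_distrr /= -sum1_card; congr (2 * _).
    rewrite big_mkcond [RHS]big_mkcond; apply: eq_bigr => f _; rewrite inE.
    by case: (f \in faces); case: eqP.
  rewrite -big_split; apply: leq_sum => f /imsetP [d _ ->] /=; rewrite card_face.
  have := order_even d; have := order_ge4 d; case: eqP => [->|] //.
  by move: (fingraph.order phi d) => n; lia.
rewrite /num_edges card_dart -[num_faces sigma]/#|faces|.
lia.
Qed.

End Rotation.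

Lemma few_quads_nonplanar (L : seq {set T}) : size L < 6 -> ~~ odd #|T| ->
    (forall a b c d, e a b -> e b c -> e c d -> e d a -> a != c -> b != d ->
       exists2 s, s \in L & s =i [:: a; b; c; d]) ->
  ~ planar e.
Proof.
move=> L6 evT hL [sigma [rot]].
have := nonplanar_rotation rot L6 evT hL.
have -> : num_isolated e = 0.
  apply/eqP; rewrite cards_eq0; apply/eqP/setP => x; rewrite !inE; apply/negP.
  move=> /forallP h; have := e_cubic x; rewrite (_ : [set u | e x u] = set0) ?cards0 //.
  by apply/setP => u; rewrite !inE (negPf (h u)).
(* Connectedness is the case of 3-connectedness where nothing is deleted. *)
have -> : num_components e = 1.
  have [T3 conn] := e_conn; have [x0 _] : exists x0 : T, x0 \in T.
    by apply/card_gt0P; apply: leq_trans T3.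
  rewrite /num_components (_ : [set _ | _ in _] = [set setT]) ?cards1 //.
  have all x : [set y | connect e x y] = setT.
    apply/setP => y; rewrite !inE; have := conn set0 _ x y; rewrite cards0 !inE.
    move=> /(_ isT isT isT); apply: connect_sub => u v /= /andP [/andP [uv _] _].
    exact: connect1.
  by apply/setP => A; rewrite inE; apply/imsetP/eqP => [[x _ ->]|->]; [|exists x0].
lia.
Qed.

End Nonplanar.

Theorem theorem17 : forall k : nat, 1 <= k ->
  exists e : rel 'I_(2 + 10 * k),
    simple_graph e /\ ~ planar e /\ three_connected e /\
    bipartite e /\ cubic e /\ Kprime3 e = 1.
Proof.
move=> k k0; have [E [p [gE kE [L [qL _ L5]]]]] := chain_exists k0.
(* The vertices are 0, ..., 1 + 10k, and [2 + 10 * k] is convertible to [(1 + 10 * k).+1]. *)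
exists (@ord_graph (1 + 10 * k) E).
have e_simple := ord_simple gE; have e_conn := ord_three_connected gE.
have e_bip := ord_bipartite gE; have e_cubic := ord_cubic gE.
do ![split=> //]; last exact: ord_Kprime3.
pose to_set (s : seq nat) := [set x : 'I_(1 + 10 * k).+1 | val x \in s].
apply: (few_quads_nonplanar e_simple e_cubic e_bip e_conn (L := map to_set L)).
- by rewrite size_map.
- by rewrite card_ord /= oddD oddM.
move=> a b c d ab bc cd da ac bd; have [s sL sE] := qL _ _ _ _ ab bc cd da ac bd.
exists (to_set s); first exact: map_f.
by move=> x; rewrite inE sE !inE.
Qed.
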